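(* Let $\mathbf k$ be a non-archimedean local field of characteristic different from $2$ and let $\bar\alpha\in\mathbf k^*/(\mathbf k^* )^2$ with $-1\notin\bar\alpha$. The group $\mathrm{Isom}(\mathbf D_{\bar\alpha})$ of projective maps in $\mathrm{GL}(3,\mathbf k)/K_{\bar\alpha}$ preserving $\mathbf D_{\bar\alpha}$ acts by isometries on $\mathbf D_{\bar\alpha}$ (for the Hilbert distance $d_{\mathbf D_{\bar\alpha}}$). It is isomorphic to $\mathrm{PGL}(2,\mathbf k)$, an element $g$ of $\mathrm{PGL}(2,\mathbf k)$ acting by $\det(g)\mathrm{Ad}(g)$. Moreover: \begin{itemize} \item its action is transitive on $\mathbf D_{\bar\alpha}\times\mathcal C_{\bar\alpha}$; \item its action is transitive on the set of long lines, and on the set of short lines; \item its action is transitive on the flags ``a point in a long line'', i.e. on pairs $(v,L)$ with $L$ a long line and $v\in L$; \item its action preserves orthogonality of lines. \end{itemize}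
   Context: Elements of $\mathbf k^*/(\mathbf k^* )^2$ are regarded as subsets of $\mathbf k^*$. $Q(x,y,z)=xz-y^2$ on $\mathbf k^3$, $B(v,v')=\frac12[Q(v+v')-Q(v-v')]$; $\perp$ refers to $B$. $\mathrm{Ad}:\mathrm{PGL}(2,\mathbf k)\to\mathrm{SO}(Q)$ is the adjoint representation, an isomorphism; concretely, identifying $(x,y,z)$ with $S=\begin{pmatrix}x & y \\ y & z\end{pmatrix}$, $\mathrm{Ad}(g)S=\det(g)^{-1}gS\,{}^tg$. $K_{\bar\alpha}=\{\alpha x^2+y^2\in\mathbf k^*: x,y\in\mathbf k^*\}$ for any $\alpha\in\bar\alpha$, an index $2$ subgroup of $\mathbf k^*$ (acting by homotheties, so seen also as scalar matrices). $\mathbf S_{\bar\alpha}=(\mathbf k^3\setminus\{0\})/K_{\bar\alpha}$. $\mathcal C_{\bar1}=\{(a,b,c)\in\mathbf k^3\setminus\{0\}: ac=b^2,\ a,c\text{ squares in }\mathbf k\ (\text{possibly }0)\}$, and in this statement $\mathcal C_{\bar\alpha}$ denotes the image of $\mathcal C_{\bar1}$ in $\mathbf S_{\bar\alpha}$. $\mathcal H_{\bar\alpha}=\{v\in\mathbf k^3: B(v,w)\in K_{\bar\alpha}\ \forall w\in\mathcal C_{\bar1}\}$, and the disc $\mathbf D_{\bar\alpha}$ is its image in $\mathbf S_{\bar\alpha}$. Hilbert distance: let $\mathbf D_{\bar\alpha}^\circ$ be the set of $\phi\in((\mathbf k^3)^*\setminus\{0\})/K_{\bar\alpha}$ with $\phi(x)\in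 K_{\bar\alpha}$ for all $x\in\mathbf D_{\bar\alpha}$. With $\mu$ a fixed Haar measure on $\mathbf k^*$, $d_{\mathbf D_{\bar\alpha}}(x,y)$ is the $\mu$-measure of the smallest symmetric ball containing $\{\frac{\phi(y)}{\phi(x)}\frac{\phi'(x)}{\phi'(y)}:\phi,\phi'\in\mathbf D_{\bar\alpha}^\circ\}$, where the symmetric ball of radius $r\ge 0$ is $\{t\in K_{\bar\alpha}:|t-1|\le r,\ |t^{-1}-1|\le r\}$. Lines: a line $l$ in $\mathbf D_{\bar\alpha}$ is the (non-empty) intersection with $\mathbf D_{\bar\alpha}$ of the image in $\mathbf S_{\bar\alpha}$ of a linear plane $P(l)\subset\mathbf k^3$. If $v$ represents a point of $l$ and $w$ spans $P(l)\cap v^\perp$ (with $v$ normalised in $\mathcal H_{\bar\alpha}$), then $l$ is a long line if $Q(w)\in-\bar\alpha$ (equivalently, $Q|_{P(l)}$ is isotropic, and the image of $P(l)$ in $\mathbf S_{\bar\alpha}$ meets $\mathcal C_{\bar\alpha}$ in exactly two points), and a short line if $Q(w)\notin-\bar\alpha$ (equivalently, $Q|_{P(l)}$ is anisotropic). Two lines $l_1,l_2$ through a point $v\in\mathbf D_{\bar\alpha}$ are orthogonal if $P(l_1)\cap v^\perp$ and $P(l_2)\cap v^\perp$ are orthogonal for $B$.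
   Formalization: Transitivity on the set of short lines is stated only when the residue characteristic of k is not 2 (|2| = 1); in residue characteristic 2 it is always false, e.g. k = Q_2, α = 1 gives three orbits of short lines. All other claims are as stated. *)

(* Defs.v *)
From HB Require Import structures.
From mathcomp Require Import all_boot all_order all_algebra.
From mathcomp Require Import ring.
From mathcomp Require Import all_classical all_reals all_analysis.

Set Implicit Arguments.
Unset Strict Implicit.
Unset Printing Implicit Defensive.

Import Order.TTheory GRing.Theory Num.Theory.
Import numFieldNormedType.Exports.

Local Open Scope classical_set_scope.
Local Open Scope ring_scope.

HB.mixin Record isUltrametricField (R : realType) K & GRing.Field K := {
  absv : K -> R ;
  absv_ge0 : forall x, 0 <= absv x ;
  absv_eq0 : forall x, absv x = 0 <-> x = 0 ;
  absvM : forall x y, absv (x * y) = absv x * absv y ;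
  absvD_max : forall x y, absv (x + y) <= Num.max (absv x) (absv y) }.

#[short(type="ultrametricFieldType")]
HB.structure Definition UltrametricField (R : realType) :=
  {K of GRing.Field K & isUltrametricField R K}.

(* The library puts a pseudometric on a ring only through numeric structures, so
   the topology of |.| lives on an alias of the field. *)
Definition topof (R : realType) (k : ultrametricFieldType R) : Type := k.

Section Topof.
Variables (R : realType) (k : ultrametricFieldType R).
Implicit Types x y z : k.

Lemma absv1 : absv (1 : k) = 1.
Proof.
apply: (@mulfI _ (absv (1 : k))); last by rewrite -absvM !mulr1.
by apply/eqP => /absv_eq0/eqP; rewrite oner_eq0.
Qed.

Lemma absvN x : absv (- x) = absv x.
Proof.
have N1 : absv (-1 : k) = 1.
  have /eqP : absv (-1 : k) ^+ 2 = 1 by rewrite expr2 -absvM mulrNN mulr1 absv1.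
  by rewrite sqrp_eq1 ?absv_ge0// => /eqP.
by rewrite -mulN1r absvM N1 mul1r.
Qed.

Let dist x y : R := absv (x - y).

Let distxx x : dist x x = 0.
Proof. by rewrite /dist subrr; apply/absv_eq0. Qed.

Let dist_eq0 x y : dist x y = 0 -> x = y.
Proof. by move=> /absv_eq0/eqP; rewrite subr_eq0 => /eqP. Qed.

Let dist_sym x y : dist x y = dist y x.
Proof. by rewrite /dist -absvN opprB. Qed.

Let dist_triangle y x z : dist x z <= dist x y + dist y z.
Proof.
rewrite /dist -(subrK y x) -addrA; apply: le_trans (absvD_max _ _) _.
by rewrite ge_max subrK lerDl lerDr !absv_ge0.
Qed.

HB.instance Definition _ := Choice.on (topof k).
HB.instance Definition _ := isPointed.Build (topof k) (0 : k).
HB.instance Definition _ := @isMetric.Build R (topof k) dist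
  distxx dist_eq0 dist_sym dist_triangle.

End Topof.

HB.mixin Record UltrametricField_isLocal (R : realType) K
    & UltrametricField R K := {
  absv_nontrivial : exists x : K, x != 0 /\ absv x != 1 ;
  topof_locally_compact : locally_compact [set: topof K] }.

#[short(type="nonArchLocalFieldType")]
HB.structure Definition NonArchLocalField (R : realType) :=
  {K of UltrametricField R K & UltrametricField_isLocal R K}.

Definition kstar (k : fieldType) : set k := [set l | l != 0].
Arguments kstar : clear implicits.

(* Elements of quotients such as (k^3 \ 0)/L, GL(3,k)/L or PGL(2,k), for L a
   subgroup of k^*, are represented by the corresponding L-orbits, as sets. *)
Definition orbit_of (k : fieldType) (V : lmodType k) (L : set k) (v : V) :
  set V := [set l *: v | l in L].

Definition coset_mul (k : fieldType) (n : nat) (f g : set 'M[k]_n) :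
  set 'M[k]_n := [set A *m B | A in f & B in g].

Definition proj_act (k : fieldType) (f : set 'M[k]_3) (p : set 'cV[k]_3) :
  set 'cV[k]_3 := [set M *m v | M in f & v in p].

Definition set_act (k : fieldType) (f : set 'M[k]_3) (l : set (set 'cV[k]_3)) :
  set (set 'cV[k]_3) := [set proj_act f p | p in l].

Definition acts_transitively (G T : Type) (act : G -> T -> T)
    (S : set G) (X : set T) : Prop :=
  (forall f x, S f -> X x -> X (act f x)) /\
  (forall x y, X x -> X y -> exists2 f, S f & act f x = y).

Section Algebra.
Variable k : fieldType.
Local Notation V := 'cV[k]_3.

Definition sqclass (a : k) : set k := [set a * t ^+ 2 | t in kstar k].

Definition sqclasses : set (set k) := [set sqclass a | a in kstar k].

Definition K_ (ba : set k) : set k :=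
  [set t | t != 0 /\
     exists a x y, [/\ ba a, x != 0, y != 0 & t = a * x ^+ 2 + y ^+ 2]].

Definition xc (v : V) : k := v 0 0.
Definition yc (v : V) : k := v 1 0.
Definition zc (v : V) : k := v 2%:R 0.

Definition Q (v : V) : k := xc v * zc v - yc v ^+ 2.
Definition B (v v' : V) : k := 2%:R^-1 * (Q (v + v') - Q (v - v')).

Definition symmx (v : V) : 'M[k]_2 :=
  \matrix_(i, j) (if (i == 0) && (j == 0) then xc v
                  else if (i == 1) && (j == 1) then zc v else yc v).
Definition vec_sym (S : 'M[k]_2) : V :=
  \col_i (if i == 0 then S 0 0 else if i == 1 then S 0 1 else S 1 1).

Definition Ad (g : 'M[k]_2) (v : V) : V :=
  vec_sym ((\det g)^-1 *: (g *m symmx v *m g^T)).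
Definition Ad_mx (g : 'M[k]_2) : 'M[k]_3 :=
  \matrix_(i, j) Ad g (delta_mx j 0) i 0.

Definition PGL2 : set (set 'M[k]_2) :=
  [set orbit_of (kstar k) g | g in [set g | g \in unitmx]].

Definition cone1 : set V :=
  [set v | [/\ v != 0, xc v * zc v = yc v ^+ 2,
     exists s, xc v = s ^+ 2 & exists t, zc v = t ^+ 2]].

Section Disc.
Variable ba : set k.
Local Notation "[ v ]_K" := (orbit_of (K_ ba) v) (at level 0).

Definition imageS (A : set V) : set (set V) :=
  [set [v]_K | v in [set v | A v /\ v != 0]].

Definition C_ : set (set V) := imageS cone1.

Definition H_ : set V := [set v | forall w, cone1 w -> K_ ba (B v w)].

Definition D_ : set (set V) := imageS H_.

Definition GL3K : set (set 'M[k]_3) :=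
  [set orbit_of (K_ ba) M | M in [set M | M \in unitmx]].

Definition IsomD : set (set 'M[k]_3) :=
  [set f | GL3K f /\ set_act f D_ = D_].

(* linear forms on k^3 are row vectors *)
Definition ev (f : 'rV[k]_3) (v : V) : k := (f *m v) 0 0.

Definition Ddual : set (set 'rV[k]_3) :=
  [set phi | (exists2 f, f != 0 & phi = orbit_of (K_ ba) f) /\
     forall f p v, phi f -> D_ p -> p v -> K_ ba (ev f v)].

Definition cross_ratios (x y : set V) : set k :=
  [set t | exists phi phi' f f' u v,
     [/\ Ddual phi, Ddual phi', phi f & phi' f'] /\
     [/\ x u, y v & t = ev f v / ev f u * (ev f' u / ev f' v)]].

(* l is a line and P is a plane P(l) defining it *)
Definition line_plane (l : set (set V)) (P : {vspace V}) : Prop :=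
  [/\ \dim P = 2%N, l = D_ `&` imageS [set` P] & l !=set0].

Definition spans_orth (P : {vspace V}) (v w : V) : Prop :=
  [set` <[w]>%VS] = [set` P] `&` [set u | B v u = 0].

Definition long_line : set (set (set V)) :=
  [set l | exists P v w, [/\ line_plane l P, H_ v, l [v]_K, spans_orth P v w
                           & ba (- Q w)]].

Definition short_line : set (set (set V)) :=
  [set l | exists P v w, [/\ line_plane l P, H_ v, l [v]_K, spans_orth P v w
                           & ~ ba (- Q w)]].

Definition long_flag : set (set V * set (set V)) :=
  [set pl | long_line pl.2 /\ pl.2 pl.1].

Definition orthogonal_at (p : set V) (l1 l2 : set (set V)) : Prop :=
  exists P1 P2 v,
    [/\ line_plane l1 P1, line_plane l2 P2, H_ v & p = [v]_K] /\
    [/\ l1 p, l2 p &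
      forall w1 w2, w1 \in P1 -> B v w1 = 0 -> w2 \in P2 -> B v w2 = 0 ->
        B w1 w2 = 0].

End Disc.

Lemma Ad_mxE (g : 'M[k]_2) (v : V) : Ad_mx g *m v = Ad g v.
Proof.
have e1 : lift ord0 ord0 = 1 :> 'I_2 by exact/val_inj.
have e2 : lift ord0 ord0 = 1 :> 'I_3 by exact/val_inj.
have e3 : lift ord0 (lift ord0 ord0) = 2%:R :> 'I_3 by exact/val_inj.
have e0 n : ord0 = 0 :> 'I_n.+1 by [].
apply/colP => i; rewrite !mxE !big_ord_recl big_ord0 e3 e2 !e0.
rewrite !mxE !big_ord_recl !big_ord0 e1 !e0 !mxE /xc /yc /zc.
case: i => [[|[|[|]]]] //= ?; rewrite ?mxE ?big_ord_recl ?big_ord0 ?e1 ?e0 ?mxE;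
  by rewrite /xc /yc /zc ?mxE /=; ring.
Qed.

End Algebra.
Arguments sqclasses : clear implicits.
Arguments PGL2 : clear implicits.

Section Distance.
Variables (R : realType) (k : nonArchLocalFieldType R).

Definition borel_type := g_sigma_algebraType (@open (topof k)).

(* A Haar measure on k^*, seen as a Borel measure on k for which {0} is null.
   Regularity is automatic, k^* being locally compact and second countable. *)
Definition is_haar (mu : {measure set borel_type -> \bar R}) : Prop :=
  [/\ mu [set (0 : k)] = 0%E,
      mu [set: k] <> 0%E,
      forall C : set k, compact (C : set (topof k)) -> ~ C 0 -> (mu C < +oo)%E
    & forall (x : k) (A : set k), x != 0 -> measurable (A : set borel_type) ->
        mu [set x * a | a in A] = mu A].

Variable ba : set k.

Definition symball (r : R) : set k :=
  [set t | [/\ K_ ba t, absv (t - 1) <= r & absv (t^-1 - 1) <= r]].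

Definition smallest_symball (A : set k) : set k :=
  \bigcap_(r in [set r | 0 <= r /\ A `<=` symball r]) symball r.

Lemma smallest_symballP (A : set k) :
  (exists2 r, 0 <= r & A `<=` symball r) ->
  exists r, [/\ 0 <= r, smallest_symball A = symball r, A `<=` symball r
    & forall r', 0 <= r' -> A `<=` symball r' -> symball r `<=` symball r'].
Proof.
move=> [r1 r1_ge0 Ar1]; pose S := [set r | 0 <= r /\ A `<=` symball r].
have S1 : S r1 by [].
have lbS : has_inf S by split; [exists r1 | exists 0 => r []].
have infS x : (forall r, S r -> x <= r) -> x <= inf S.
  by move=> h; apply: lb_le_inf; [exists r1 | move=> r /h].
have inf_le r : S r -> inf S <= r by move=> ?; apply: ge_inf => //; case: lbS.
have sub r r' : r <= r' -> symball r `<=` symball r'.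
  by move=> rr' t [Kt t1 t2]; split=> //; apply: le_trans rr'.
have Ainf : A `<=` symball (inf S).
  move=> t At; have [Kt _ _] := Ar1 _ At.
  by split=> //; apply: infS => r [_ /(_ _ At)[]].
exists (inf S); split=> //; first by apply: infS => r [].
- apply/seteqP; split=> t; last by move=> ht r Sr; exact: sub (inf_le _ Sr) _ ht.
  move=> ht; have [Kt _ _] := ht _ S1.
  by split=> //; apply: infS => r Sr; case: (ht _ Sr).
- by move=> r' r'0 Ar'; apply: sub; apply: inf_le.
Qed.

(* Isom(D) multiplies Q by squares, so the class of Q(w) modulo squares is an
   invariant of a line, and over all lines it takes every value in -K modulo
   squares: the short lines have a single class exactly when k has four square
   classes, i.e. when its residue characteristic is not 2. *)
Definition odd_residue_char : Prop := absv (2%:R : k) = 1.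

Definition hilbert_dist (mu : {measure set borel_type -> \bar R})
    (x y : set 'cV[k]_3) : \bar R :=
  mu (smallest_symball (cross_ratios ba x y)).

End Distance.
Arguments odd_residue_char {R} k.

(* Main.v *)
(* In terms of symmetric matrices, g acts by S |-> g S g^T, and S lies in H when the
   binary form S only takes values in K, the norm group of k(sqrt(-alpha)). Such an
   S has its first coefficient in K, and the norm group of k(sqrt(-det S)) lies in K.
   By nondegeneracy of the Hilbert symbol, det S is then in the class of alpha, so
   that S is in the orbit of diag(1, alpha), up to a factor in K. The stabilizer of
   the class of diag(1, alpha) is the multiplicative group of k(sqrt(-alpha)): it is
   transitive on nonzero vectors, hence on the cone, and by Hilbert 90 it permutes
   transitively the lines of the orthogonal plane on which Q has a given class.

   Nondegeneracy of the Hilbert symbol, including in residue characteristic 2, comes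
   from counting: the norms of k(sqrt a) modulo squares form the cokernel of doubling
   on the norm one torus T_a (Hilbert 90), with T_1 = k^*. By comparison with the
   subgroup of elements close to 1, where doubling is multiplication by 2, the order
   of this cokernel is 2 |O/2O| if a is not a square, and 4 |O/2O| if a = 1. Hence
   norm groups have index 2.

   Conversely, the vectors e + t^2 u, with e in the cone and u suitable, are in H for
   all t != 0. Since squares are open, a linear map preserving H then sends e to an
   isotropic vector when t tends to 0. So it preserves Q up to a factor. *)
Require Import Defs.
From HB Require Import structures.
From mathcomp Require Import all_boot all_order all_algebra.
From mathcomp Require Import finmap zify ring lra.
From mathcomp Require Import all_classical all_reals all_analysis.

Set Implicit Arguments.
Unset Strict Implicit.
Unset Printing Implicit Defensive.

Import Order.TTheory GRing.Theory Num.Theory.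
Import numFieldNormedType.Exports.

Local Open Scope classical_set_scope.
Local Open Scope ring_scope.

(** [rho] g is S |-> g S g^T, that is det(g) Ad(g). The factor det(g) matters: it may lie outside K,
    and then Ad(g) alone takes the disc off itself. A scalar s acts by s^2, which is in K, so the
    action descends to PGL(2). The obstacle is that H is defined by infinitely many conditions, one
    for each vector of the cone. Nondegeneracy of the Hilbert symbol replaces them by two conditions
    on classes ([H_char]), from which the orbits and the isometries are read off. In the counts, a
    factor 2 comes from the element -1 of the torus: it doubles to 0, and has to be kept out of the
    subgroup on which doubling is studied. The second factor 2 for a = 1 is the parity of the
    exponent of the chosen element of absolute value < 1. Only the ratio of the two counts matters
    for the index, so the number |O/2O| drops out of it. *)

(** * Counting classes *)

(* T/e has n elements, and f is the class map. *)
Definition index_is (A : Type) (T : set A) (e : A -> A -> Prop) (n : nat) :=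
  exists f : A -> 'I_n, (forall i, exists2 x, T x & f x = i) /\
    (forall x y, T x -> T y -> (f x = f y <-> e x y)).

(** A relation coarser than the fibres of a map to a finite type has finitely many classes: a class
    is coded by the set of values that [g] takes on it. *)
Lemma index_exists (A : Type) (T : set A) (e : A -> A -> Prop) (F : finType)
    (g : A -> F) :
  (exists x, T x) -> (forall x y, T x -> T y -> e x y -> e y x) ->
  (forall x y z, T x -> T y -> T z -> e x y -> e y z -> e x z) ->
  (forall x y, T x -> T y -> g x = g y -> e x y) ->
  exists n, index_is T e n.
Proof.
move=> [x0 Tx0] esym etrans ge.
pose c x : {set F} := [set i | `[< exists y, [/\ T y, e x y & g y = i] >]]%SET.
pose J : {set {set F}} := [set s | `[< exists2 x, T x & c x = s >]]%SET.
have J0 : c x0 \in J by rewrite inE; apply/asboolP; exists x0.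
have JT x : T x -> c x \in J by move=> Tx; rewrite inE; apply/asboolP; exists x.
exists #|J|, (fun x => enum_rank_in J0 (c x)); split.
  move=> i; have := enum_valP i; rewrite inE => /asboolP[x Tx cx].
  by exists x => //; rewrite cx enum_valK_in.
move=> x y Tx Ty; split=> [/enum_rank_in_inj|exy].
  move=> /(_ (JT _ Tx) (JT _ Ty)) cxy.
  have : g y \in c y by rewrite inE; apply/asboolP; exists y; split=> //; exact: ge.
  rewrite -cxy inE => /asboolP[z [Tz exz gzy]].
  exact: etrans exz (ge _ _ _ _ gzy).
congr enum_rank_in; apply/setP => i; rewrite !inE.
apply/asbool_equiv_eq; split=> -[z [Tz ez gz]]; exists z; split=> //.
- exact: etrans (esym _ _ _ _ exy) ez.
- exact: etrans exy ez.
Qed.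

Lemma index_unique (A : Type) (T : set A) (e : A -> A -> Prop) (m n : nat) :
  index_is T e m -> index_is T e n -> m = n.
Proof.
wlog suff le_mn : m n / index_is T e m -> index_is T e n -> (m <= n)%N.
  by move=> Tm Tn; apply/eqP; rewrite eqn_leq !le_mn.
move=> [f [fs fe]] [g [_ ge]].
have /choice[r rP] i : exists x, T x /\ f x = i by have [x] := fs i; exists x.
rewrite -[m]card_ord -[n]card_ord; apply: (@leq_card _ _ (g \o r)) => i j /= gij.
have [[Ti <-] [Tj <-]] := (rP i, rP j).
by apply/(fe _ _ Ti Tj)/(ge _ _ Ti Tj).
Qed.

Lemma card_uniform_fibers (I J : finType) (h : I -> J) (c : nat) :
  (forall i, #|[set j | h j == h i]%SET| = c) ->
  #|I| = (#|[set h i | i : I]%SET| * c)%N.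
Proof.
move=> hc; rewrite -[LHS]sum1_card.
have hI i : i \in I -> h i \in [set h i | i : I]%SET.
  by move=> _; apply/imsetP; exists i.
rewrite (partition_big h _ hI) /= -sum_nat_const.
apply: eq_bigr => _ /imsetP[i _ ->].
by rewrite sum1_card -(hc i); apply: eq_card => j; rewrite inE.
Qed.

(* The kernel and the cokernel of doubling on the finite group A/2P have the same
   order, and the kernel is (P + {0, w})/2P. *)
Lemma index_double (A : zmodType) (w : A) (P : set A) (F : finType)
    (g : A -> F) (n : nat) :
  w + w = 0 -> (forall x, x + x = 0 -> x = 0 \/ x = w) ->
  P 0 -> (forall x y, P x -> P y -> P (x - y)) -> ~ P w ->
  (forall x y, g x = g y -> P (x - y)) ->
  index_is P (fun x y => exists2 u, P u & x - y = u + u) n ->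
  index_is [set: A] (fun x y => exists u, x - y = u + u) (2 * n).
Proof.
move=> ww tors P0 PB Pw gP [fP [fPs fPe]].
have PN x : P x -> P (- x) by move=> Px; rewrite -sub0r; exact: PB.
have PD x y : P x -> P y -> P (x + y).
  by move=> Px Py; rewrite -[y]opprK; apply/PB/PN.
have symE B : (forall u : A, B u -> B (- u)) -> forall x y,
    (exists2 u, B u & x - y = u + u) -> exists2 u, B u & y - x = u + u.
  move=> BN x y [u Bu xy]; exists (- u); first exact: BN.
  by rewrite -[LHS]opprB xy opprD.
have trE B : (forall u v : A, B u -> B v -> B (u + v)) -> forall x y z,
    (exists2 u, B u & x - y = u + u) -> (exists2 u, B u & y - z = u + u) ->
    exists2 u, B u & x - z = u + u.
  move=> BD x y z [u Bu xy] [v Bv yz]; exists (u + v); first exact: BD.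
  by rewrite addrACA -xy -yz addrA subrK.
have [rep repP] : {rep : F -> A | forall x, P (x - rep (g x))}.
  have /choice[r rP] i : exists a : A, (exists x, g x = i) -> g a = i.
    by have [[x xi]|no] := pselect (exists x, g x = i);
      [exists x | exists 0].
  by exists r => x; apply: gP; rewrite rP//; exists x.
(* A/2P is finite: x is known up to 2P from [g x] and from the class in P/2P of its difference with
   the representative of [g x]. *)
have [N [f [fs fe]]] :
    exists N, index_is [set: A] (fun x y => exists2 u, P u & x - y = u + u) N.
  apply: (@index_exists _ _ _ _ (fun x => (g x, fP (x - rep (g x))))).
  - by exists 0.
  - by move=> x y _ _; exact: symE.
  - by move=> x y z _ _ _; exact: trE.
  - move=> x y _ _ [gxy /fPe] => /(_ (repP _) (repP _)).
    by rewrite gxy opprB addrA subrK.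
have [m [h [hs he]]] :
    exists m, index_is [set: A] (fun x y => exists u, x - y = u + u) m.
  have eqE x y : (exists u : A, x - y = u + u) <->
                 (exists2 u, True & x - y = u + u).
    by split=> -[u]; exists u.
  apply: (@index_exists _ _ _ _ f); first by exists 0.
  - move=> x y _ _ /eqE xy; apply/eqE; exact: symE xy.
  - move=> x y z _ _ _ /eqE xy /eqE yz; apply/eqE; exact: trE xy yz.
  - by move=> x y _ _ /(fe _ _ Logic.I Logic.I)[u _ xy]; exists u.
have {}fe x y : f x = f y <-> exists2 u, P u & x - y = u + u by exact: fe.
have {}he x y : h x = h y <-> exists u, x - y = u + u by exact: he.
have /choice[r rK] i : exists x, f x = i by have [x _] := fs i; exists x.
have hr i x : f x = i -> h (r i) = h x.
  by move=> fxi; apply/he; have /fe[u _ ->] := etrans (rK i) (esym fxi); exists u.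
pose d i := f (r i + r i).
have dE i x : f x = i -> d i = f (x + x).
  move=> fxi; have /fe[u Pu xu] := etrans (rK i) (esym fxi).
  apply/fe; exists (u + u); first exact: PD.
  by rewrite opprD addrACA xu.
have shift (a : A) : injective (fun i => f (r i - a)).
  move=> i j /fe[u Pu]; rewrite opprB addrA subrK => ij.
  by rewrite -(rK i) -(rK j); apply/fe; exists u.
pose ker := [set j | d j == d (f 0)]%SET.
have NE1 : N = (#|[set d i | i : 'I_N]%SET| * #|ker|)%N.
  rewrite -[LHS]card_ord; apply: card_uniform_fibers => i.
  rewrite -(card_imset ker (shift (- r i))) /=; apply: eq_card => j.
  rewrite inE; apply/eqP/imsetP => [dji|[l]].
    exists (f (r j - r i)); last first.
      rewrite -[LHS](rK j); apply/fe.
      have /fe[u Pu uE] := rK (f (r j - r i)); exists (- u); first exact: PN.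
      by rewrite -opprD -uE [RHS]opprB opprK [X in _ + X]opprD addrA addrAC.
    rewrite inE; apply/eqP; rewrite (dE _ _ erefl) (dE (f 0) 0 erefl).
    move/fe : dji => [u Pu uE]; apply/fe; exists u => //.
    by rewrite -uE addr0 subr0 opprD addrACA.
  rewrite inE => /eqP dl ->; rewrite (dE _ _ erefl) /d.
  move: dl; rewrite (dE (f 0) 0 erefl) => /fe[u Pu uE]; apply/fe; exists u => //.
  by rewrite -uE !opprK addrACA addrK addr0 subr0.
(* The fibres of A/2P -> A/2A are the translates of the image of doubling. Comparison with [NE1]
   shows that cokernel and kernel have the same order. *)
have NE2 : N = (m * #|[set d i | i : 'I_N]%SET|)%N.
  rewrite -[LHS]card_ord (@card_uniform_fibers _ _ (h \o r)
      #|[set d i | i : 'I_N]%SET|) //=.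
    congr (_ * _)%N; rewrite -[RHS]card_ord -cardsT; apply: eq_card => i.
    rewrite [RHS]inE; have [x _ <-] := hs i.
    by apply/imsetP; exists (f x) => //=; rewrite (hr _ x).
  move=> i; rewrite -(card_imset _ (shift (r i))); apply: eq_card => j.
  apply/imsetP/imsetP => -[l].
    rewrite inE => /eqP/= /he[u uE] ->; exists (f u) => //.
    by rewrite (dE _ _ erefl) uE.
  move=> _ ->; exists (f (r l + r l + r i)).
    rewrite inE /=; apply/eqP; rewrite (hr _ _ erefl); apply/he; exists (r l).
    by rewrite addrK.
  have /fe[u Pu uE] := rK (f (r l + r l + r i)).
  apply/fe; exists (- u); first exact: PN.
  by rewrite -opprD -uE !opprB addrA.
have N0 : (0 < N)%N by rewrite (leq_ltn_trans _ (ltn_ord (f 0))).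
have mker : m = #|ker|.
  have := etrans (esym NE2) NE1; move: N0; rewrite {1}NE1 muln_gt0 => /andP[D0 _].
  by move=> /eqP; rewrite mulnC eqn_pmul2l// => /eqP.
suff -> : (2 * n)%N = m by exists h; split => // x y _ _; exact: he.
have /choice[s sP] i : exists x, P x /\ fP x = i by have [x] := fPs i; exists x.
have Ps i : P (s i) by case: (sP i).
have sK i : fP (s i) = i by case: (sP i).
(* This lists the kernel by a multiple of w and a class of P/2P. The list has no repetition because
   w is not in P. *)
pose k (bi : bool * 'I_n) := f (w *+ bi.1 + s bi.2).
have wb (b : bool) : w *+ b + w *+ b = 0 by case: b; rewrite ?mulr1n ?mulr0n ?addr0.
have kinj : injective k.
  move=> [b i] [c j] /fe[u Pu] /= uE.
  have Pbc : P (w *+ b - w *+ c).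
    have -> : w *+ b - w *+ c = (u + u) - (s i - s j).
      by rewrite -uE opprD addrACA addrK.
    exact: PB (PD _ _ Pu Pu) (PB _ _ (Ps i) (Ps j)).
  have bc : b = c.
    case: b c Pbc {uE} => -[] //; rewrite ?mulr1n ?mulr0n ?subr0 ?sub0r => Pb //.
    by case: Pw; rewrite -[w]opprK; exact: PN.
  subst c; congr pair; rewrite -(sK i) -(sK j); apply/fPe => //.
  by exists u => //; rewrite -uE opprD addrACA subrr add0r.
rewrite mker -[LHS](_ : #|{: bool * 'I_n}| = _); last first.
  by rewrite card_prod card_bool card_ord.
rewrite -cardsT -(card_imset _ kinj); apply: eq_card => i.
apply/imsetP/idP => [[[b j] _ ->]|].
  rewrite inE (dE (f 0) 0 erefl) (dE _ _ erefl) /=; apply/eqP/fe.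
  exists (s j) => //; rewrite addr0 subr0 addrACA.
  by rewrite wb add0r.
rewrite inE (dE (f 0) 0 erefl) => /eqP/fe[u Pu]; rewrite addr0 subr0 => uE.
have [c ru] : exists c : bool, r i = w *+ c + u.
  have /tors[|] : (r i - u) + (r i - u) = 0 by rewrite addrACA uE -opprD subrr.
    by move=> /eqP; rewrite subr_eq0 => /eqP ->; exists false; rewrite add0r.
  move=> /eqP; by rewrite subr_eq => /eqP ->; exists true.
exists (c, fP u) => //.
rewrite -[LHS]rK /k /= ru; apply/fe.
have /(fPe _ _ Pu (Ps _))[v Pv vE] : fP u = fP (s (fP u)) by rewrite sK.
by exists v => //; rewrite -vE opprD addrACA subrr add0r.
Qed.

(** * Topology of the field *)

Section LocalField.
Variables (R : realType) (k : nonArchLocalFieldType R).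
Implicit Types x y z c s t : k.

Lemma absv0 : absv (0 : k) = 0.
Proof. exact/absv_eq0. Qed.

Lemma absv_gt0 x : (0 < absv x) = (x != 0).
Proof.
rewrite lt_def absv_ge0 andbT; congr (~~ _).
by apply/eqP/eqP => /absv_eq0.
Qed.

Lemma absvV x : absv x^-1 = (absv x)^-1.
Proof.
have [->|x0] := eqVneq x 0; first by rewrite !invr0 absv0 invr0.
have ax : absv x != 0 by rewrite gt_eqF// absv_gt0.
by apply: (mulfI ax); rewrite -absvM !divff// absv1.
Qed.

Lemma absvX x n : absv (x ^+ n) = absv x ^+ n.
Proof. by elim: n => [|n IH]; rewrite ?expr0 ?absv1// !exprS absvM IH. Qed.

Lemma absvB x y : absv (x - y) = absv (y - x).
Proof. by rewrite -absvN opprB. Qed.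

Lemma absvD_le x y (e : R) : absv x <= e -> absv y <= e -> absv (x + y) <= e.
Proof. by move=> xe ye; rewrite (le_trans (absvD_max _ _))// ge_max xe. Qed.

Lemma absvB_le x y (e : R) : absv x <= e -> absv y <= e -> absv (x - y) <= e.
Proof. by move=> xe ye; apply: absvD_le; rewrite ?absvN. Qed.

Lemma absvD_lt x y (e : R) : absv x < e -> absv y < e -> absv (x + y) < e.
Proof. by move=> xe ye; rewrite (le_lt_trans (absvD_max _ _))// gt_max xe. Qed.

Lemma absvB_lt x y (e : R) : absv x < e -> absv y < e -> absv (x - y) < e.
Proof. by move=> xe ye; apply: absvD_lt; rewrite ?absvN. Qed.

Lemma absvD_eq x y : absv x < absv y -> absv (x + y) = absv y.
Proof.
move=> xy; apply/eqP; rewrite eq_le absvD_le ?(ltW xy)//=.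
rewrite leNgt; apply/negP => lt; have := absvB_lt lt xy.
by rewrite [x + y]addrC addrK ltxx.
Qed.

Lemma absv2_le1 : absv (2%:R : k) <= 1.
Proof. by rewrite (absvD_le (x := 1) (y := 1))// absv1. Qed.

Lemma exists_absv_lt1 : exists r : k, r != 0 /\ absv r < 1.
Proof.
have [x [x0 x1]] := @absv_nontrivial R k.
have [xlt|xgt] := ltP (absv x) 1; first by exists x.
exists x^-1; rewrite invr_eq0 x0; split=> //.
by rewrite absvV invf_lt1 ?absv_gt0// lt_neqAle eq_sym x1.
Qed.

Lemma exists_small (e : R) : 0 < e -> exists2 c : k, c != 0 & absv c < e.
Proof.
move=> e0; have [r [r0 r1]] := exists_absv_lt1.
have /cvgrPdist_lt/(_ _ e0)[n _ /(_ n (leqnn n))] : (absv r) ^+ n @[n --> \oo] --> (0 : R).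
  by apply: cvg_expr; rewrite ger0_norm ?absv_ge0.
rewrite /= sub0r normrN ger0_norm ?exprn_ge0 ?absv_ge0// => rn.
by exists (r ^+ n); rewrite ?expf_neq0// absvX.
Qed.

Lemma ball_absv (x : topof k) (e : R) : ball x e = [set y | absv ((x : k) - y) < e].
Proof. by []. Qed.

Lemma nbhs_absv (x : topof k) (A : set (topof k)) :
  nbhs x A <-> exists2 e : R, 0 < e & forall y, absv ((x : k) - y) < e -> A y.
Proof.
split=> [/nbhs_ballP[e /= e0 xe]|[e e0 xe]]; first by exists e.
by apply/nbhs_ballP; exists e => // y; exact: xe.
Qed.

Lemma absv_continuous (f : topof k -> topof k) :
  (forall (x : topof k) (e : R), 0 < e -> exists2 d : R, 0 < d &
     forall y, absv ((x : k) - y) < d -> absv ((f x : k) - f y) < e) ->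
  continuous (fun x : topof k => absv (f x : k) : R).
Proof.
move=> fc x; apply/(@cvgrPdist_lt _ R^o _ (nbhs x) (@nbhs_filter (topof k) x)) => e e0.
have [d d0 xd] := fc x e e0; apply/(@nbhs_absv x); exists d => // y /xd; apply: le_lt_trans.
have tri (u v : k) : absv u <= absv (u - v) + absv v.
  rewrite -{1}(subrK v u) (le_trans (absvD_max _ _))//.
  by rewrite ge_max lerDl lerDr !absv_ge0.
rewrite ler_norml lerBlDr tri andbT lerBrDr addrC lerBlDr addrC absvB.
exact: tri.
Qed.

Lemma closed_cball (e : R) :
  closed ([set x : topof k | absv (x : k) <= e] : set (topof k)).
Proof.
have /continuous_closedP/(_ [set y | y <= e]) :
    continuous (fun x : topof k => absv (x : k) : R).
  by apply: (@absv_continuous idfun) => x d d0; exists d.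
by apply; exact: closed_le.
Qed.

Lemma compact_cball : exists2 e : R, 0 < e &
  compact ([set x : topof k | absv (x : k) <= e] : set (topof k)).
Proof.
have [U] := @topof_locally_compact R k (0 : k) Logic.I.
rewrite withinET => /nbhs_absv[d d0 Ud] [cU _].
exists (d / 2) => //; first by rewrite divr_gt0.
apply: (subclosed_compact (@closed_cball _) cU) => x /= xd; apply: Ud.
rewrite sub0r absvN (le_lt_trans xd)//.
by rewrite ltr_pdivrMr// ltr_pMr// ltr1n.
Qed.


(** Multiplication by a small constant brings any ball into a compact one, which finitely many balls
    of small radius cover; by the ultrametric inequality two points of the same small ball are
    close. The value [None] is reserved for points outside the compact ball. *)
Lemma totally_bounded (M d : R) : 0 < d ->
  exists (F : finType) (g : k -> F), forall x y,
    absv x <= M -> absv y <= M -> g x = g y -> absv (x - y) <= d.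
Proof.
have [e e0 ce] := compact_cball.
move: d; suff small (d : R) : 0 < d -> exists (F : finType) (g : k -> F),
    forall x y, absv x <= e -> absv y <= e -> g x = g y -> absv (x - y) <= d.
  have M1 : 0 < 1 + `|M| by rewrite ltr_wpDr.
  move=> d d0; have [c c0 cM] := exists_small (divr_gt0 e0 M1).
  have ac0 : 0 < absv c by rewrite absv_gt0.
  have [F [g gP]] := small (absv c * d) (mulr_gt0 ac0 d0).
  exists F, (fun x => g (c * x)) => x y xM yM gxy.
  have cle z : absv z <= M -> absv (c * z) <= e.
    move=> zM; rewrite absvM.
    have zM1 : absv z <= 1 + `|M|.
      by rewrite (le_trans zM)// (le_trans (ler_norm M))// lerDr.
    rewrite (le_trans (ler_pM (absv_ge0 _) (absv_ge0 _) (ltW cM) zM1))// divfK//.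
  have := gP _ _ (cle _ xM) (cle _ yM) gxy.
  by rewrite -mulrBr absvM ler_pM2l.
move=> d0.
have := ce; rewrite compact_cover => /(_ (topof k) setT (fun i => (ball i d)^°)).
case=> [i _|x xe|D _ Dcov].
- exact: open_interior.
- by exists x => //; apply: nbhsx_ballx.
have /choice[g gP] (x : k) : exists i : option D,
    absv x <= e -> oapp (fun j : D => ball (val j : topof k) d x) False i.
  have [xe|xe] := boolP (absv x <= e); last by exists None.
  have [i Di /interior_subset xi] := Dcov x xe.
  by exists (Some (FSetSub Di)).
exists (option D), g => x y /gP xg /gP + gxy; rewrite -gxy.
case: (g x) xg => //= i; rewrite !ball_absv /= => xi yi; apply: ltW.
by rewrite -(subrK (val i : k) x) -addrA absvD_lt// absvB.
Qed.

(* A minimum of |s^2 - c| on a small compact ball is 0, since the Newton step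
   s - (s^2 - c)/(2 s) would otherwise decrease it. *)
Lemma sqrt_near1 (e : R) : (2%:R : k) != 0 -> 0 < e -> exists2 rho : R,
  0 < rho < e & forall t, absv t <= absv (2%:R : k) * rho ->
    exists2 s, absv (s - 1) <= rho & s ^+ 2 = 1 + t.
Proof.
move=> two0 e0; have [d d0 cd] := compact_cball.
have a20 : 0 < absv (2%:R : k) by rewrite absv_gt0.
have m0 : 0 < Num.min e (Num.min d (absv (2%:R : k))) by rewrite !lt_min e0 d0.
have [r r0 r_small] := exists_small m0.
move: r_small; rewrite !lt_min => /and3P[re rd r2].
(* The bound |r| < |2| does two things: it makes 1 + h and h + 2 of absolute values 1 and |2| for
   |h| <= |r|, and it makes the Newton step contract. *)
exists (absv r); first by rewrite absv_gt0 r0.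
have r1 : absv r < 1 by rewrite (lt_le_trans r2)// absv2_le1.
move=> t tr; pose N (h : k) : k := (1 + h) ^+ 2 - (1 + t).
have cr : compact ([set x : topof k | absv (x : k) <= absv r] : set (topof k)).
  apply: (subclosed_compact (@closed_cball _) cd) => x /= /le_trans; apply.
  exact: ltW.
have cN : continuous (fun x : topof k => absv (N x) : R).
  apply: (@absv_continuous N) => x e' e'0.
  have M0 : 0 < 1 + absv (x : k) by rewrite ltr_wpDr ?absv_ge0.
  exists (Num.min 1 (e' / (1 + absv (x : k)))) => [|y].
    by rewrite lt_min ltr01 divr_gt0.
  rewrite lt_min => /andP[xy1 xye].
  have -> : N x - N y = ((x : k) - y) * (2%:R + ((x : k) + y)).
    by rewrite /N; ring.
  have -> : 2%:R + ((x : k) + y) = 2%:R + 2%:R * (x : k) - ((x : k) - y) by ring.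
  have le : absv (2%:R + 2%:R * (x : k) - ((x : k) - y)) <= 1 + absv (x : k).
    have x1 : 1 <= 1 + absv (x : k) by rewrite lerDl absv_ge0.
    apply: absvB_le; last exact: le_trans (ltW xy1) x1.
    apply: absvD_le; first exact: le_trans absv2_le1 x1.
    rewrite absvM (le_trans (ler_wpM2r (absv_ge0 _) absv2_le1))// mul1r.
    by rewrite lerDr.
  by rewrite absvM (le_lt_trans (ler_wpM2l (absv_ge0 _) le))// -ltr_pdivlMr.
have [|h] := @compact_EVT_min _ R _ _ _ cr (continuous_subspaceT cN).
  by exists (0 : k); rewrite /= absv0 absv_ge0.
rewrite inE /= => hr hmin.
have s1 : absv (1 + h : k) = 1.
  by rewrite addrC absvD_eq absv1// (le_lt_trans hr).
have s0 : 1 + h != 0 :> k by rewrite -absv_gt0 s1.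
have [Nh0|Nh0] := eqVneq (N h) 0.
  exists (1 + h : k); first by rewrite addrC addKr.
  by apply/eqP; rewrite -subr_eq0; exact/eqP.
have Nh : absv (N h) <= absv (2%:R : k) * absv r.
  have -> : N h = (h : k) * (h + 2%:R) - t by rewrite /N; ring.
  apply: absvB_le => //; rewrite absvM absvD_eq ?(le_lt_trans hr)// mulrC.
  by rewrite ler_pM2l.
pose h' : k := h - N h / (2%:R * (1 + h)).
have h'r : absv h' <= absv r.
  apply: absvB_le => //; rewrite absvM absvV absvM s1 mulr1.
  by rewrite ler_pdivrMr// mulrC.
have Nh' : N h' = N h ^+ 2 / (2%:R * (1 + h)) ^+ 2.
  by rewrite /N /h' /N; field; rewrite s0 two0.
have := hmin h'; rewrite inE /= => /(_ h'r).
(* Minimality gives |N h| <= |N h|^2 / |2|^2, hence |2|^2 <= |N h| <= |2| |r|, against |r| < |2|. *)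
rewrite Nh' absvM absvV !absvX absvM s1 mulr1 expr2 -mulrA.
rewrite -[leLHS]mulr1 ler_pM2l ?absv_gt0// ler_pdivlMr ?exprn_gt0// mul1r.
move=> /le_trans/(_ Nh); rewrite expr2 ler_pM2l// leNgt.
by rewrite r2.
Qed.

Lemma squares_open : (2%:R : k) != 0 -> exists2 d : R, 0 < d &
  forall t, absv t <= d -> exists s, s ^+ 2 = 1 + t.
Proof.
move=> two0; have [rho /andP[rho0 _] rhoP] := sqrt_near1 two0 ltr01.
exists (absv (2%:R : k) * rho); first by rewrite mulr_gt0// absv_gt0.
by move=> t /rhoP[s _ st]; exists s.
Qed.

(** This number is |O/2O|, the unit in which all the counts below are expressed. *)
Lemma index_mod2_exists : (2%:R : k) != 0 -> exists n,
  index_is [set x : k | absv x <= 1] (fun x y => absv (x - y) <= absv (2%:R : k)) n.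
Proof.
rewrite -absv_gt0 => /(@totally_bounded 1)[F [g gP]].
apply: (index_exists (g := g)) gP => [|x y _ _|x y z _ _ _ xy yz].
- by exists 0; rewrite /= absv0.
- by rewrite absvB.
- by rewrite -(subrK y x) -addrA absvD_le.
Qed.

End LocalField.

(** * Norms of quadratic extensions *)

Section Norms.
Variable F : fieldType.
Implicit Types a b c s t x y : F.

Definition norms (a : F) : set F :=
  [set t | t != 0 /\ exists x y, t = x ^+ 2 - a * y ^+ 2].

Definition nonsquare (a : F) : Prop := forall r, a <> r ^+ 2.

Lemma norms_neq0 a t : norms a t -> t != 0.
Proof. by case. Qed.

Lemma norms_sqr a s : s != 0 -> norms a (s ^+ 2).
Proof. by move=> s0; split; [rewrite expf_neq0 | exists s, 0; ring]. Qed.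

Lemma norms_mul a s t : norms a s -> norms a t -> norms a (s * t).
Proof.
move=> [s0 [x [y sE]]] [t0 [x' [y' tE]]]; split; first by rewrite mulf_neq0.
by exists (x * x' + a * (y * y')), (x * y' + y * x'); rewrite sE tE; ring.
Qed.

Lemma norms_mul_sqr a s t : s != 0 -> norms a (t * s ^+ 2) <-> norms a t.
Proof.
move=> s0; split=> [|Nt]; last exact: norms_mul Nt (norms_sqr _ s0).
move=> /norms_mul/(_ (norms_sqr a (s := s^-1) _)).
by rewrite invr_eq0 -mulrA -exprMn divff// expr1n mulr1; exact.
Qed.

Lemma norms_inv a t : norms a t -> norms a t^-1.
Proof.
move=> Nt; have t0 := norms_neq0 Nt.
apply/(@norms_mul_sqr a t _ t0); have -> : t^-1 * t ^+ 2 = t by field.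
by [].
Qed.

(** Symmetry of the Hilbert symbol: b = x^2 - a y^2 is solved for a when y is nonzero. Otherwise b
    is the square of x, its norm form is split, and a is the product of (a + 1)/2 + (a - 1)/2 and (a
    + 1)/2 - (a - 1)/2. *)
Lemma norms_sym a b : (2%:R : F) != 0 -> a != 0 -> norms a b -> norms b a.
Proof.
move=> two0 a0 [b0 [x [y bE]]]; split=> //.
have [y0|y0] := eqVneq y 0; last first.
  exists (x / y), y^-1; rewrite bE; field; exact: y0.
have x0 : x != 0 by apply: contraNneq b0 => x0; rewrite bE x0 y0; apply/eqP; ring.
exists ((a + 1) / 2%:R), ((a - 1) / (2%:R * x)).
by rewrite bE y0; field; rewrite x0 two0.
Qed.

Lemma norms_1 t : (2%:R : F) != 0 -> norms 1 t <-> t != 0.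
Proof.
move=> two0; split=> [[]//|t0]; split=> //.
by exists ((t + 1) / 2%:R), ((t - 1) / 2%:R); field.
Qed.

End Norms.

(* The norm one torus of k[X]/(X^2 - a), written additively. *)
Definition conic (F : fieldType) (a : F) :=
  {z : F * F | z.1 ^+ 2 - a * z.2 ^+ 2 == 1}.

Section Conic.
Variables (F : fieldType) (a : F).
Implicit Types z w : conic a.

HB.instance Definition _ := Choice.on (conic a).

Definition cx z := (val z).1.
Definition cy z := (val z).2.

Lemma conicP z : cx z ^+ 2 - a * cy z ^+ 2 = 1.
Proof. exact/eqP/(valP z). Qed.

Lemma conic_eq z w : cx z = cx w -> cy z = cy w -> z = w.
Proof.
move=> xx yy; apply: val_inj; move: xx yy; rewrite /cx /cy.
by case: (val z) (val w) => [? ?] [? ?] /= -> ->.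
Qed.

Definition mkconic x y (xy : x ^+ 2 - a * y ^+ 2 = 1) : conic a :=
  exist _ (x, y) (introT eqP xy).

Lemma cx_mk x y (xy : x ^+ 2 - a * y ^+ 2 = 1) : cx (mkconic xy) = x.
Proof. by []. Qed.
Lemma cy_mk x y (xy : x ^+ 2 - a * y ^+ 2 = 1) : cy (mkconic xy) = y.
Proof. by []. Qed.

Fact conic_zero_subproof : 1 ^+ 2 - a * 0 ^+ 2 = 1 :> F.
Proof. by ring. Qed.
Definition conic_zero := mkconic conic_zero_subproof.

Fact conic_opp_subproof z : cx z ^+ 2 - a * (- cy z) ^+ 2 = 1.
Proof. by rewrite sqrrN conicP. Qed.
Definition conic_opp z := mkconic (conic_opp_subproof z).

Fact conic_add_subproof z w :
  (cx z * cx w + a * (cy z * cy w)) ^+ 2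
  - a * (cy z * cx w + cx z * cy w) ^+ 2 = 1.
Proof.
transitivity ((cx z ^+ 2 - a * cy z ^+ 2) * (cx w ^+ 2 - a * cy w ^+ 2)).
  by ring.
by rewrite !conicP mulr1.
Qed.
Definition conic_add z w := mkconic (conic_add_subproof z w).

Fact conic_addA : associative conic_add.
Proof. by move=> x y z; apply: conic_eq; rewrite !(cx_mk, cy_mk); ring. Qed.

Fact conic_addC : commutative conic_add.
Proof. by move=> x y; apply: conic_eq; rewrite !(cx_mk, cy_mk); ring. Qed.

Fact conic_add0 : left_id conic_zero conic_add.
Proof. by move=> x; apply: conic_eq; rewrite !(cx_mk, cy_mk); ring. Qed.

Fact conic_addN : left_inverse conic_zero conic_opp conic_add.
Proof.
move=> x; apply: conic_eq; rewrite !(cx_mk, cy_mk); last by ring.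
by rewrite -[RHS](conicP x); ring.
Qed.

HB.instance Definition _ := GRing.isZmodule.Build (conic a)
  conic_addA conic_addC conic_add0 conic_addN.

Lemma cxD z w : cx (z + w) = cx z * cx w + a * (cy z * cy w).
Proof. by []. Qed.
Lemma cyD z w : cy (z + w) = cy z * cx w + cx z * cy w.
Proof. by []. Qed.
Lemma cxN z : cx (- z) = cx z. Proof. by []. Qed.
Lemma cyN z : cy (- z) = - cy z. Proof. by []. Qed.
Lemma cx0 : cx 0 = 1. Proof. by []. Qed.
Lemma cy0 : cy 0 = 0. Proof. by []. Qed.

Fact conic_m1_subproof : (-1) ^+ 2 - a * 0 ^+ 2 = 1 :> F.
Proof. by ring. Qed.
Definition conic_m1 := mkconic conic_m1_subproof.

Lemma conic_m1D : conic_m1 + conic_m1 = 0.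
Proof. by apply: conic_eq; rewrite ?cxD ?cyD !(cx_mk, cy_mk); ring. Qed.

Hypothesis two0 : (2%:R : F) != 0.

Lemma conic_tors z : z + z = 0 -> z = 0 \/ z = conic_m1.
Proof.
move=> zz; have := congr1 cx zz; have := congr1 cy zz.
rewrite cxD cyD cx0 cy0 => y2 x2.
have : (cx z) ^+ 2 = 1.
  apply: (mulfI two0); transitivity
    ((cx z * cx z + a * (cy z * cy z)) + (cx z ^+ 2 - a * cy z ^+ 2)); first by ring.
  by rewrite x2 conicP mulr1.
move=> /eqP; rewrite sqrf_eq1 => x1.
have x0 : cx z != 0.
  by case/orP: x1 => /eqP ->; rewrite ?oppr_eq0 oner_eq0.
have y0 : cy z = 0.
  have : 2%:R * cx z * cy z = 0 by rewrite -[RHS]y2; ring.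
  by move=> /eqP; rewrite !mulf_eq0 (negPf two0) (negPf x0) /= => /eqP.
by case/orP: x1 => /eqP xE; [left|right]; apply: conic_eq; rewrite ?xE ?y0.
Qed.

End Conic.

Lemma index_is_fin (A : Type) (T : set A) (e : A -> A -> Prop) (I : finType)
    (f : A -> I) :
  (forall i, exists2 x, T x & f x = i) ->
  (forall x y, T x -> T y -> (f x = f y <-> e x y)) -> index_is T e #|I|.
Proof.
move=> fs fe; exists (fun x => enum_rank (f x)); split=> [i|x y Tx Ty].
  by have [x Tx fx] := fs (enum_val i); exists x; rewrite // fx enum_valK.
by rewrite -fe//; split=> [/enum_rank_inj|->].
Qed.

(** Pigeonhole: the classes of S inject into those of T, and there are as many. This turns an
    equality of counts into a statement about each element. *)
Lemma index_cover (A : Type) (S T : set A) (e : A -> A -> Prop) (n : nat) :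
  S `<=` T -> index_is S e n -> index_is T e n ->
  forall x, T x -> exists2 y, S y & e x y.
Proof.
move=> ST [f [fs fe]] [g [_ ge]] x Tx.
have /choice[r rP] i : exists y, S y /\ f y = i by have [y] := fs i; exists y.
have rinj : injective (g \o r).
  move=> i j /= /(ge _ _ (ST _ (rP i).1) (ST _ (rP j).1)).
  by move=> /(fe _ _ (rP i).1 (rP j).1); rewrite (rP i).2 (rP j).2.
have [h hK gK] := injF_bij rinj.
exists (r (h (g x))); first exact: (rP _).1.
by apply/(ge _ _ Tx (ST _ (rP _).1)); have := gK (g x).
Qed.

Section NormClasses.
Variables (F : fieldType) (a : F).
Hypotheses (two0 : (2%:R : F) != 0) (a0 : a != 0).
Implicit Types (s t x y : F) (z w : conic a).

Let n x y : F := x ^+ 2 - a * y ^+ 2.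

Fact norm_ratio_subproof x y : n x y != 0 ->
  ((x ^+ 2 + a * y ^+ 2) / n x y) ^+ 2 - a * (2%:R * x * y / n x y) ^+ 2 = 1.
Proof. by rewrite /n => n0; field. Qed.
(* The quotient of x + y sqrt a by its conjugate. *)
Definition norm_ratio x y (n0 : n x y != 0) := mkconic (norm_ratio_subproof n0).

(** Hilbert 90: z is the quotient of 1 + z by its conjugate, except for z = -1, which is the
    quotient of sqrt a by its conjugate. *)
Lemma norm_ratio_surj z : exists x y (n0 : n x y != 0), norm_ratio n0 = z.
Proof.
have zP := conicP z.
have [xm1|x1] := eqVneq (cx z) (-1).
  have y0 : cy z = 0.
    have /eqP : a * cy z ^+ 2 = 0.
      transitivity ((-1) ^+ 2 - (cx z ^+ 2 - a * cy z ^+ 2)).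
        by rewrite xm1; ring.
      by rewrite zP; ring.
    by rewrite mulf_eq0 (negPf a0) sqrf_eq0 => /eqP.
  have n0 : n 0 1 != 0 by rewrite /n expr0n expr1n mulr1 sub0r oppr_eq0.
  exists 0, 1, n0; apply: conic_eq; rewrite !(cx_mk, cy_mk).
    by rewrite xm1 /n; field; rewrite oppr_eq0.
  by rewrite y0 mulr0 !mul0r.
have x10 : 1 + cx z != 0 by rewrite addrC -[1]opprK subr_eq0.
have nE : n (1 + cx z) (cy z) = 2%:R * (1 + cx z).
  transitivity ((cx z ^+ 2 - a * cy z ^+ 2) + 1 + 2%:R * cx z); first by rewrite /n; ring.
  by rewrite zP; ring.
have n0 : n (1 + cx z) (cy z) != 0 by rewrite nE mulf_neq0.
exists (1 + cx z), (cy z), n0; apply: conic_eq; rewrite !(cx_mk, cy_mk) nE.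
  have -> : a * cy z ^+ 2 = cx z ^+ 2 - 1 by rewrite -zP; ring.
  by field; rewrite x10 two0.
by field; rewrite x10 two0.
Qed.

(** Let A + B sqrt a be the product of x + y sqrt a and the conjugate of x' + y' sqrt a. Its norm is
    the product N N' of the two norms, and the difference of the two ratios, written
    multiplicatively, is (A + B sqrt a)^2 / (N N'). If N N' is a square, a square root in the torus
    is visible. Conversely, dividing A + B sqrt a by a square root in the torus gives an element
    whose square and norm are both N N', which makes N N' a square in the base field. *)
Lemma norm_ratio_eq x y x' y' (n0 : n x y != 0) (n0' : n x' y' != 0) :
  (exists r, n x y = n x' y' * r ^+ 2) <->
  exists w, norm_ratio n0 - norm_ratio n0' = w + w.
Proof.
pose A := x * x' - a * (y * y'); pose B := y * x' - x * y'.
split=> [[r nE]|[w wE]].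
  have r0 : r != 0.
    by apply: contraNneq n0 => r0; rewrite nE r0 expr0n mulr0.
  have wP : (A / (n x' y' * r)) ^+ 2 - a * (B / (n x' y' * r)) ^+ 2 = 1.
    transitivity (n x y * n x' y' / (n x' y' * r) ^+ 2).
      by rewrite /A /B; move: n0'; rewrite /n => n0'; field; rewrite r0.
    by rewrite nE; field; rewrite r0 n0'.
  exists (mkconic wP); apply: conic_eq; rewrite !(cxD, cyD, cxN, cyN, cx_mk, cy_mk).
    transitivity ((A ^+ 2 + a * B ^+ 2) / (n x' y' * (n x' y' * r ^+ 2))).
      rewrite -nE /A /B; move: n0 n0'; rewrite /n => n0 n0'.
      by field; rewrite n0 n0'.
    by field; rewrite r0 n0'.
  transitivity (2%:R * A * B / (n x' y' * (n x' y' * r ^+ 2))).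
    rewrite -nE /A /B; move: n0 n0'; rewrite /n => n0 n0'.
    by field; rewrite n0 n0'.
  by field; rewrite r0 n0'.
set N := n x y; set N' := n x' y'.
have NN0 : N * N' != 0 by rewrite mulf_neq0.
have ABn : A ^+ 2 - a * B ^+ 2 = N * N' by rewrite /A /B /N /N' /n; ring.
have := congr1 (@cx F a) wE; have := congr1 (@cy F a) wE.
rewrite !(cxD, cyD, cxN, cyN, cx_mk, cy_mk) -/N -/N'.
set e := cx w; set f := cy w => yE xE.
have {}yE : 2%:R * (A * B) = N * N' * (2%:R * (e * f)).
  transitivity (N * N' * (f * e + e * f)); last by ring.
  by rewrite -yE /A /B /N /N'; move: (n0) (n0'); rewrite /n => h h'; field; rewrite h h'.
have {}xE : A ^+ 2 + a * B ^+ 2 = N * N' * (e ^+ 2 + a * f ^+ 2).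
  transitivity (N * N' * (e * e + a * (f * f))); last by ring.
  by rewrite -xE /A /B /N /N'; move: (n0) (n0'); rewrite /n => h h'; field; rewrite h h'.
have ef : e ^+ 2 - a * f ^+ 2 = 1 by exact: conicP.
(* W1 + W2 sqrt a is (A + B sqrt a) / (e + f sqrt a), whose square is N N'. *)
pose W1 := A * e - a * (B * f); pose W2 := B * e - A * f.
have Wn : W1 ^+ 2 - a * W2 ^+ 2 = N * N'.
  transitivity ((A ^+ 2 - a * B ^+ 2) * (e ^+ 2 - a * f ^+ 2)).
    by rewrite /W1 /W2; ring.
  by rewrite ABn ef mulr1.
have Wp : W1 ^+ 2 + a * W2 ^+ 2 = N * N'.
  transitivity ((A ^+ 2 + a * B ^+ 2) * (e ^+ 2 + a * f ^+ 2)
     - 2%:R * (A * B) * (2%:R * a * (e * f))); first by rewrite /W1 /W2; ring.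
  rewrite xE yE; transitivity (N * N' * (e ^+ 2 - a * f ^+ 2) ^+ 2); first by ring.
  by rewrite ef expr1n mulr1.
have W1E : W1 ^+ 2 = N * N'.
  apply: (mulfI two0); transitivity
    ((W1 ^+ 2 - a * W2 ^+ 2) + (W1 ^+ 2 + a * W2 ^+ 2)); first by ring.
  by rewrite Wn Wp; ring.
exists (W1 / N'); rewrite exprMn W1E.
by field.
Qed.

Lemma norms_index m :
  index_is [set: conic a] (fun z w => exists u, z - w = u + u) m ->
  index_is (norms a) (fun s t => exists r, s = t * r ^+ 2) m.
Proof.
move=> [f [fs fe]].
have /choice[q qP] t : exists z, norms a t ->
    exists x y (n0 : n x y != 0), t = n x y /\ z = norm_ratio n0.
  have [[t0 [x [y tE]]]|Nt] := pselect (norms a t); last by exists 0.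
  have n0 : n x y != 0 by rewrite /n -tE.
  by exists (norm_ratio n0) => _; exists x, y, n0.
have qe s t : norms a s -> norms a t ->
    (exists r, s = t * r ^+ 2) <-> exists u, q s - q t = u + u.
  move=> /qP[x [y [n0 [-> ->]]]] /qP[x' [y' [n0' [-> ->]]]].
  exact: norm_ratio_eq.
exists (f \o q); split=> [i|s t Ns Nt /=]; last by rewrite fe// qe.
have [z _ <-] := fs i; have [x [y [n0 <-]]] := norm_ratio_surj z.
have Nn : norms a (n x y) by split=> //; exists x, y.
exists (n x y) => //=; apply/fe => //.
have [x' [y' [n0' [nE ->]]]] := qP _ Nn.
by apply/norm_ratio_eq; exists 1; rewrite expr1n mulr1.
Qed.

End NormClasses.

(** * Doubling near the identity of the torus *)

Section SmallSubgroup.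
Variables (R : realType) (k : nonArchLocalFieldType R).
Hypothesis two0 : (2%:R : k) != 0.
Variables (a c : k) (rho : R).
Hypotheses (rho2 : rho < absv (2%:R : k))
  (rhoP : forall t : k, absv t <= absv (2%:R : k) * rho ->
     exists2 s, absv (s - 1) <= rho & s ^+ 2 = 1 + t)
  (c0 : c != 0) (ac : absv a * absv c ^+ 2 <= absv (2%:R : k) * rho).
Implicit Types (x y s t b : k) (z w : conic a).

(** The coordinate y is the parameter: for |y| <= |c|, 1 + a y^2 is a square by [rhoP]. The
    condition on x only selects the square root close to 1, and so excludes -1. *)
Definition small : set (conic a) :=
  [set z | absv (cy z) <= absv c /\ absv (cx z - 1) < absv (2%:R : k)].

Let a2_gt0 : 0 < absv (2%:R : k). Proof. by rewrite absv_gt0. Qed.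

Let rho22 : absv (2%:R : k) * rho < absv (2%:R : k).
Proof.
by rewrite gtr_pMr// (lt_le_trans rho2)// absv2_le1.
Qed.

Let absv_cx z : small z -> absv (cx z) = 1.
Proof.
move=> [_ zx]; rewrite -(subrK 1 (cx z)) absvD_eq absv1//.
by rewrite (lt_le_trans zx)// absv2_le1.
Qed.

Let absv_ayy y y' : absv y <= absv c -> absv y' <= absv c ->
  absv (a * (y * y')) <= absv (2%:R : k) * rho.
Proof.
move=> yc y'c; rewrite absvM (le_trans _ ac)// absvM.
by rewrite ler_wpM2l ?absv_ge0// expr2 ler_pM// absv_ge0.
Qed.

Lemma small0 : small 0.
Proof. by rewrite /small /= cx0 cy0 subrr absv0 absv_ge0. Qed.

Lemma smallB z w : small z -> small w -> small (z - w).
Proof.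
move=> sz sw; have [zy zx] := sz; have [wy wx] := sw.
rewrite /small /= cxD cyD cxN cyN; split.
  by apply: absvD_le; rewrite absvM ?absvN absv_cx// ?mulr1 ?mul1r.
have -> : cx z * cx w + a * (cy z * - cy w) - 1 =
  (cx z - 1) * cx w + (cx w - 1) - a * (cy z * cy w) by ring.
apply: absvB_lt; last exact: le_lt_trans (absv_ayy zy wy) rho22.
by apply: absvD_lt => //; rewrite absvM (absv_cx sw) mulr1.
Qed.

Lemma small_m1 : ~ small (conic_m1 a).
Proof.
move=> [_]; rewrite cx_mk.
have -> : -1 - 1 = - 2%:R :> k by ring.
by rewrite absvN ltxx.
Qed.

Let absv_cxB1 z : small z -> absv (cx z - 1) * absv (2%:R : k) = absv (a * (cy z * cy z)).
Proof.
move=> [zy zx]; have -> : a * (cy z * cy z) = (cx z - 1) * ((cx z - 1) + 2%:R).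
  transitivity (cx z ^+ 2 - (cx z ^+ 2 - a * cy z ^+ 2)); first by ring.
  by rewrite conicP; ring.
by rewrite absvM [absv (_ + 2%:R)]absvD_eq.
Qed.

(** Doubling multiplies y by 2 x, and |x| = 1 on the small subgroup. Halving is the half-angle
    formula, with x coordinate s such that s^2 = (1 + x)/2 and y coordinate y/(2 s); the bound on y
    puts this s^2 in the range of [rhoP]. *)
Lemma small_doubleP z :
  (exists2 u, small u & z = u + u) <->
  small z /\ absv (cy z) <= absv (2%:R : k) * absv c.
Proof.
split=> [[u su ->]|[sz zy]].
  split.
    rewrite -[X in u + X]opprK -[X in u - X]sub0r.
    exact: smallB su (smallB small0 su).
  have -> : cy (u + u) = 2%:R * (cx u * cy u) by rewrite cyD; ring.
  by rewrite absvM ler_pM2l// absvM (absv_cx su) mul1r; case: su.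
have [t tE] : exists t, t = (cx z - 1) / 2%:R by exists ((cx z - 1) / 2%:R).
have at_ : absv t <= absv (2%:R : k) * rho.
  rewrite tE absvM absvV -(ler_pM2r (exprn_gt0 2 a2_gt0)).
  have -> : absv (cx z - 1) / absv (2%:R : k) * absv (2%:R : k) ^+ 2 =
            absv (cx z - 1) * absv (2%:R : k).
    by field; rewrite gt_eqF.
  rewrite (absv_cxB1 sz) absvM.
  rewrite (le_trans (ler_wpM2l (absv_ge0 _) _)
    (_ : _ * (absv (2%:R : k) * absv c) ^+ 2 <= _))//.
    by rewrite absvM expr2 ler_pM// absv_ge0.
  by rewrite exprMn mulrCA mulrC ler_pM2r ?exprn_gt0.
have [s s1 sE] := rhoP at_.
have as1 : absv s = 1.
  rewrite -(subrK 1 s) absvD_eq absv1// (le_lt_trans s1)//.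
  by rewrite (lt_le_trans rho2)// absv2_le1.
have s0 : s != 0 by rewrite -absv_gt0 as1.
have sE2 : s ^+ 2 = (cx z + 1) / 2%:R by rewrite sE tE; field.
have x10 : cx z + 1 != 0.
  apply: contraNneq s0 => x10; move: sE2; rewrite x10 mul0r => /eqP.
  by rewrite sqrf_eq0.
have four0 : 4%:R != 0 :> k.
  by rewrite (_ : 4%:R = 2%:R * 2%:R :> k) ?mulf_neq0//; ring.
have uP : s ^+ 2 - a * (cy z / (2%:R * s)) ^+ 2 = 1.
  have -> : a * (cy z / (2%:R * s)) ^+ 2 = (cx z ^+ 2 - 1) / (4%:R * s ^+ 2).
    transitivity ((cx z ^+ 2 - (cx z ^+ 2 - a * cy z ^+ 2)) / (4%:R * s ^+ 2)).
      by field; rewrite s0 two0 four0.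
    by rewrite conicP.
  by rewrite sE2; field; rewrite x10 two0 four0.
exists (mkconic uP).
  split; rewrite !(cx_mk, cy_mk); last exact: le_lt_trans s1 rho2.
  by rewrite absvM absvV absvM as1 mulr1 ler_pdivrMr// mulrC.
apply: conic_eq; rewrite !(cxD, cyD, cx_mk, cy_mk); last by field; rewrite s0 two0.
transitivity (2%:R * s ^+ 2 - (s ^+ 2 - a * (cy z / (2%:R * s)) ^+ 2)); last by ring.
by rewrite uP sE2; field.
Qed.

(** The coordinate y/c identifies the classes with O/2O: the group law differs from the addition of
    the y coordinates by terms of size at most |2| |c|, which [small_doubleP] ignores. *)
Lemma small_index n :
  index_is [set x : k | absv x <= 1] (fun x y => absv (x - y) <= absv (2%:R : k)) n ->
  index_is small (fun z w => exists2 u, small u & z - w = u + u) n.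
Proof.
move=> [f [fs fe]].
have c_gt0 : 0 < absv c by rewrite absv_gt0.
have le1 z : small z -> absv (cy z / c) <= 1.
  by case=> zy _; rewrite absvM absvV ler_pdivrMr// mul1r.
exists (fun z => f (cy z / c)); split=> [i|z w sz sw].
  have [y y1 <-] := fs i.
  have yc : absv (y * c) <= absv c by rewrite absvM ler_piMl// ltW.
  have [s s1 sE] := rhoP (absv_ayy yc yc).
  have zP : s ^+ 2 - a * (y * c) ^+ 2 = 1 by rewrite sE; ring.
  exists (mkconic zP); last by rewrite cy_mk mulfK.
  by split; rewrite !(cx_mk, cy_mk)//; exact: le_lt_trans s1 rho2.
rewrite (fe _ _ (le1 _ sz) (le1 _ sw)) small_doubleP.
rewrite -mulrBl absvM absvV ler_pdivrMr//.
have cyE : cy (z - w) = (cy z - cy w) +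
    ((cx w - 1) * cy z - (cx z - 1) * cy w) by rewrite cyD cxN cyN; ring.
have Dle : absv ((cx w - 1) * cy z - (cx z - 1) * cy w) <=
    absv (2%:R : k) * absv c.
  case: sz sw => zy zx [wy wx].
  by apply: absvB_le; rewrite absvM ler_pM ?absv_ge0// ltW.
split=> [zw|[_ zw]]; first by split; [exact: smallB | rewrite cyE absvD_le].
have -> : cy z - cy w = cy (z - w) - ((cx w - 1) * cy z - (cx z - 1) * cy w).
  by rewrite cyE; ring.
exact: absvB_le.
Qed.

(** The y coordinate of z - w and its x coordinate minus 1 are linear in the differences of
    coordinates, with coefficients bounded on a bounded part. A fine enough finite partition of k
    thus separates the cosets of the small subgroup. *)
Lemma small_finite_index (M : R) : exists (I : finType) (g : conic a -> I),
  forall z w, absv (cx z) <= M -> absv (cy z) <= M ->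
    absv (cx w) <= M -> absv (cy w) <= M -> g z = g w -> small (z - w).
Proof.
pose M' := 1 + `|M|; have M'0 : 0 < M' by rewrite ltr_wpDr.
have leM t : absv t <= M -> absv t <= M'.
  by move=> /le_trans; apply; rewrite (le_trans (ler_norm M))// lerDr.
(* Closeness m implies both conditions of [small], the strict one because |2|/2 < |2| in R; [d] is m
   divided by a bound for the coefficients, which are a coordinate times 1 or a. *)
pose m := Num.min (absv c) (absv (2%:R : k) / 2%:R).
have m0 : 0 < m by rewrite lt_min divr_gt0// absv_gt0 c0.
have a1 : 0 < 1 + absv a by rewrite ltr_wpDr ?absv_ge0.
pose d := m / (M' * (1 + absv a)).
have d0 : 0 < d by rewrite divr_gt0// mulr_gt0.
have [I [g gP]] := @totally_bounded R k M d d0.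
exists (I * I)%type, (fun z => (g (cx z), g (cy z))) => z w zx zy wx wy [gx gy].
have xd := gP _ _ zx wx gx; have yd := gP _ _ zy wy gy.
have lem b s t : absv b <= 1 + absv a -> absv s <= d -> absv t <= M ->
    absv (b * (s * t)) <= m.
  move=> ba sd tM; rewrite !absvM -[m](divfK (lt0r_neq0 (mulr_gt0 M'0 a1))) -/d.
  rewrite [leRHS]mulrA [leRHS]mulrC ler_pM ?mulr_ge0 ?absv_ge0// ler_pM ?absv_ge0//.
  exact: leM.
have one_le : absv (1 : k) <= 1 + absv a by rewrite absv1 lerDl absv_ge0.
have le_a : absv a <= 1 + absv a by rewrite lerDr.
split.
  have -> : cy (z - w) = 1 * ((cy z - cy w) * cx w) - 1 * ((cx z - cx w) * cy w).
    by rewrite cyD cxN cyN; ring.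
  by apply: absvB_le; rewrite (le_trans (lem _ _ _ _ _ _))// ge_min lexx.
have -> : cx (z - w) - 1 = 1 * ((cx z - cx w) * cx w) - a * ((cy z - cy w) * cy w).
  transitivity (cx (z - w) - (cx w ^+ 2 - a * cy w ^+ 2)); first by rewrite conicP.
  by rewrite cxD cxN cyN; ring.
apply: (@le_lt_trans _ _ m); first by apply: absvB_le; exact: lem.
by rewrite gt_min ltr_pdivrMr// ltr_pMr// ltr1n orbT.
Qed.

End SmallSubgroup.

(** * Index of the norm groups *)

Section NormIndex.
Variables (R : realType) (k : nonArchLocalFieldType R).
Hypothesis two0 : (2%:R : k) != 0.
Implicit Types (a b s t x y : k).

(** If a y^2 were large, x^2 = a y^2 (1 + 1/(a y^2)) would have a square as its last factor, since
    squares are open, and a would be a square. *)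
Lemma conic_bounded a : a != 0 -> nonsquare a -> exists M : R,
  forall z : conic a, absv (cx z) <= M /\ absv (cy z) <= M.
Proof.
move=> a0 na; have [d0 d0_gt0 d0P] := squares_open two0.
pose d := Num.min d0 2%:R^-1.
have d_gt0 : 0 < d by rewrite lt_min d0_gt0 invr_gt0 ltr0n.
have d_lt1 : d < 1 by rewrite gt_min invf_lt1 ?ltr0n// ltr1n orbT.
have aa : 0 < absv a by rewrite absv_gt0.
have le_ay (z : conic a) : absv (a * cy z ^+ 2) <= d^-1.
  rewrite leNgt; apply/negP => lt.
  have y0 : cy z != 0.
    apply: contraTneq lt => ->; rewrite expr0n mulr0 absv0 -leNgt.
    by rewrite invr_ge0 ltW.
  have ay0 : a * cy z ^+ 2 != 0 by rewrite mulf_neq0// expf_neq0.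
  have [s sE] : exists s, s ^+ 2 = 1 + (a * cy z ^+ 2)^-1.
    apply: d0P; rewrite absvV (le_trans (ltW _) (_ : d <= _))//; last first.
      by rewrite ge_min lexx.
    by rewrite invf_plt ?posrE ?absv_gt0.
  have xE : cx z ^+ 2 = a * cy z ^+ 2 * s ^+ 2.
    transitivity ((cx z ^+ 2 - a * cy z ^+ 2) + a * cy z ^+ 2); first by ring.
    by rewrite conicP sE; field; rewrite y0 a0.
  have s0 : s != 0.
    have : s ^+ 2 != 0.
      rewrite sE -absv_gt0 addrC absvD_eq ?absv1// absvV.
      by rewrite invf_lt1 ?absv_gt0// (lt_trans _ lt)// invf_gt1.
    by rewrite sqrf_eq0.
  apply: (na (cx z / (cy z * s))).
  by rewrite expr_div_n xE; field; rewrite y0 s0.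
have di0 : 0 <= d^-1 by rewrite invr_ge0 ltW.
have M1 : 1 <= d^-1 by rewrite invf_ge1// ltW.
exists (d^-1 + d^-1 / absv a) => z.
have sqle (u e : R) : 0 <= u -> 1 <= e -> u ^+ 2 <= e -> u <= e.
  move=> u0 e1 ue; rewrite leNgt; apply/negP => eu.
  have u1 : 1 < u by exact: le_lt_trans eu.
  have : u < u ^+ 2 by rewrite expr2 ltr_pMl ?(lt_trans ltr01).
  by move=> /(lt_trans eu)/lt_le_trans/(_ ue); rewrite ltxx.
have y2 : absv (cy z) ^+ 2 <= d^-1 / absv a.
  by rewrite ler_pdivlMr// mulrC -absvX -absvM.
split.
  apply: sqle; first exact: absv_ge0.
    by rewrite (le_trans M1)// lerDl divr_ge0 ?absv_ge0.
  apply: (@le_trans _ _ d^-1); last by rewrite lerDl divr_ge0 ?absv_ge0.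
  rewrite -absvX.
  have -> : cx z ^+ 2 = (cx z ^+ 2 - a * cy z ^+ 2) + a * cy z ^+ 2 by ring.
  by rewrite conicP absvD_le ?absv1.
apply: sqle; first exact: absv_ge0.
  by rewrite (le_trans M1)// lerDl divr_ge0 ?absv_ge0.
by rewrite (le_trans y2)// lerDr.
Qed.

Lemma small_params a : exists (c : k) (rho : R), [/\ rho < absv (2%:R : k),
  (forall t, absv t <= absv (2%:R : k) * rho ->
     exists2 s, absv (s - 1) <= rho & s ^+ 2 = 1 + t),
  c != 0, absv c < 1 & absv a * absv c ^+ 2 <= absv (2%:R : k) * rho].
Proof.
have a2 : 0 < absv (2%:R : k) by rewrite absv_gt0.
have [rho /andP[rho0 rho2] rhoP] := sqrt_near1 two0 a2.
have a1 : 0 < 1 + absv a by rewrite ltr_wpDr ?absv_ge0.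
have e0 : 0 < Num.min 1 (absv (2%:R : k) * rho / (1 + absv a)).
  by rewrite lt_min ltr01 divr_gt0// mulr_gt0.
have [c c0] := @exists_small R k _ e0; rewrite lt_min => /andP[c1 cl].
exists c, rho; split=> //.
rewrite (@le_trans _ _ ((1 + absv a) * absv c))//; last first.
  by rewrite mulrC -ler_pdivlMr// ltW.
rewrite ler_pM ?absv_ge0 ?exprn_ge0 ?absv_ge0// ?lerDr//.
by rewrite expr2 ler_piMl ?absv_ge0// ltW.
Qed.

(** The integer i is a rounded logarithm of v in base q. It serves to bring an element of the split
    torus into a bounded region by a power of a fixed element. *)
Lemma exists_log (q v : R) : 0 < q < 1 -> 0 < v ->
  exists i : int, q <= v / q ^ i <= q^-1.
Proof.
move=> /andP[q0 q1].
have q1' : 1 <= q^-1 by rewrite invf_ge1// ltW.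
wlog v1 : v / v <= 1 => [wl|v0].
  have [v1|v1] := leP v 1; first exact: wl.
  move=> v0; have qi (i : int) : 0 < v * q ^ i by rewrite mulr_gt0// exprz_gt0.
  have vV0 : 0 < v^-1 by rewrite invr_gt0.
  have vV1 : v^-1 <= 1 by rewrite invf_le1// ltW.
  have [i] := wl _ vV1 vV0.
  rewrite -invfM => /andP[i1 i2]; exists (- i); rewrite -invr_expz invrK.
  apply/andP; split; first by rewrite -lef_pV2 ?posrE.
  by rewrite -[v * _]invrK lef_pV2 ?posrE ?invr_gt0.
have /cvgrPdist_lt/(_ _ v0)[N _ /(_ N (leqnn N))] : q ^+ m @[m --> \oo] --> (0 : R).
  by apply: cvg_expr; rewrite ger0_norm ?ltW.
rewrite /= sub0r normrN ger0_norm ?exprn_ge0 ?ltW// => qN.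
have exN : exists m, q ^+ m < v by exists N.
case: (ex_minnP exN) => -[|m] qm mmin; first by move: qm; rewrite expr0 ltNge v1.
have qm' : v <= q ^+ m by rewrite leNgt; apply/negP => /mmin; rewrite ltnn.
exists (m : int); rewrite -exprnP; apply/andP; split.
  by rewrite ler_pdivlMr ?exprn_gt0// -exprS ltW.
by rewrite (le_trans _ q1')// ler_pdivrMr ?exprn_gt0// mul1r.
Qed.

Lemma int_odd_decomp (i : int) : exists m : int, i = m + m + (odd `|i|%N)%:Z.
Proof.
case: i => m.
  exists (m./2 : int); rewrite /= -!PoszD; congr Posz.
  by rewrite addnn addnC odd_double_half.
exists (- (uphalf m.+1)%:Z); rewrite NegzE abszN absz_nat uphalf_half.
by rewrite -{1}[m.+1]odd_double_half -addnn !PoszD; ring.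
Qed.

Section Count.
Variable n : nat.
Hypothesis index_mod2 : index_is [set x : k | absv x <= 1]
  (fun x y => absv (x - y) <= absv (2%:R : k)) n.

(** The torus is bounded, so the small subgroup has finite index in it and can serve as P. *)
Lemma index_nonsquare a : a != 0 -> nonsquare a ->
  index_is (norms a) (fun s t => exists r, s = t * r ^+ 2) (2 * n).
Proof.
move=> a0 na; apply: norms_index => //.
have [c [rho [rho2 rhoP c0 c1 ac]]] := small_params a.
have [M MP] := conic_bounded a0 na.
have [I [g gP]] := small_finite_index two0 a c0 M.
apply: (index_double (w := conic_m1 a) (P := small c) (g := g)).
- exact: conic_m1D.
- exact: conic_tors.
- exact: small0.
- exact: smallB ac.
- exact: small_m1.
- by move=> z w gzw; apply: gP gzw; case: (MP z); case: (MP w).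
- exact: small_index ac n index_mod2.
Qed.

(* The norm one torus of k x k is k^*, for which doubling is studied on the
   subgroup generated by a small one and by an element of absolute value < 1. *)
Lemma index_split : index_is (norms (1 : k)) (fun s t => exists r, s = t * r ^+ 2)
  (2 * (2 * n)).
Proof.
apply: norms_index => //; first exact: oner_neq0.
have [c [rho [rho2 rhoP c0 c1 ac]]] := small_params 1.
have [r [r0 r1]] := exists_absv_lt1 k.
have ar : 0 < absv r by rewrite absv_gt0.
(* The map z |-> x + y identifies the split torus with k^*, the inverse of x + y being x - y; [v] is
   the absolute value carried over. *)
pose v (z : conic (1 : k)) := absv (cx z + cy z).
have vD z w : v (z + w) = v z * v w.
  by rewrite /v -absvM; congr absv; rewrite cxD cyD; ring.
have v0 : v 0 = 1 by rewrite /v cx0 cy0 addr0 absv1.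
have v_gt0 z : 0 < v z.
  rewrite lt_def absv_ge0 andbT; apply/negP => /eqP vz0.
  by have := vD z (- z); rewrite subrr v0 vz0 mul0r => /eqP; rewrite oner_eq0.
have vN z : v (- z) = (v z)^-1.
  apply: (mulfI (lt0r_neq0 (v_gt0 z))).
  by rewrite -vD subrr v0 divff// lt0r_neq0.
have vMn z m : v (z *+ m) = v z ^+ m.
  by elim: m => [|m IH]; rewrite ?mulr0n ?expr0// mulrS exprS vD IH.
have vMz z (i : int) : v (z *~ i) = v z ^ i.
  by case: i => m; rewrite ?NegzE ?mulrNz -?pmulrn ?vN vMn// exprnN.
(* The point of the torus with x + y = r. Its powers meet the small subgroup trivially, as small
   elements have [v] equal to 1. *)
have gP : ((r + r^-1) / 2%:R) ^+ 2 - 1 * ((r - r^-1) / 2%:R) ^+ 2 = 1.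
  by field; rewrite two0 r0.
pose g := mkconic gP.
have vg : v g = absv r.
  by rewrite /v !(cx_mk, cy_mk); congr absv; field; rewrite two0 r0.
have vsmall z : small c z -> v z = 1.
  move=> [zy zx]; rewrite /v addrC absvD_eq.
    by rewrite -(subrK 1 (cx z)) absvD_eq absv1// (lt_le_trans zx)// absv2_le1.
  rewrite (le_lt_trans zy)// (lt_le_trans c1)//.
  by rewrite -(subrK 1 (cx z)) absvD_eq absv1// (lt_le_trans zx)// absv2_le1.
have vgz (i j : int) z w : small c z -> small c w ->
    g *~ i + z = g *~ j + w -> i = j.
  move=> sz sw /(congr1 v); rewrite !vD !vMz vg !vsmall// !mulr1.
  by apply: ieexprIz; rewrite // lt_eqF.
pose P : set (conic (1 : k)) := [set z | exists i : int, small c (z - g *~ i)].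
have sB (z w : conic (1 : k)) : small c z -> small c w -> small c (z - w).
  by move=> sz sw; exact: (smallB two0 rho2 ac).
have s0 : small c (0 : conic (1 : k)) by exact: small0.
have [f [fs fe]] := small_index two0 rho2 rhoP c0 ac index_mod2.
have /choice[e eP] z : exists i : int, P z -> small c (z - g *~ i).
  by have [[i zi]|nP] := pselect (P z); [exists i | exists 0].
have gP1 z (i : int) : small c (z - g *~ i) -> e z = i.
  move=> zi; have := eP z (ex_intro _ i zi) => ze.
  by apply: (vgz _ _ _ _ ze zi); rewrite [LHS]addrCA [RHS]addrCA !subrr.
have subg z w (i i' : int) :
    z - w - g *~ (i - i') = (z - g *~ i) - (w - g *~ i').
  by rewrite mulrzBr !opprD addrACA.
have bound z : exists j : int,
    absv r <= v (z - g *~ j) <= (absv r)^-1.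
  have [||i iP] := @exists_log (absv r) (v z); rewrite ?ar//.
  by exists i; rewrite vD vN vMz vg.
have [j jP] := choice bound.
have [I [h hP]] := small_finite_index two0 (1 : k) c0 ((absv r)^-1 / absv (2%:R : k)).
(* The coordinates are half the sum and half the difference of x + y and its inverse, whence the
   division by |2|. *)
have coord z : absv r <= v z <= (absv r)^-1 ->
    absv (cx z) <= (absv r)^-1 / absv (2%:R : k) /\
    absv (cy z) <= (absv r)^-1 / absv (2%:R : k).
  have a2 : 0 < absv (2%:R : k) by rewrite absv_gt0.
  move=> /andP[z1 z2].
  have z3 : v (- z) <= (absv r)^-1 by rewrite vN lef_pV2 ?posrE.
  rewrite !ler_pdivlMr// -!absvM; split.
    have -> : cx z * 2%:R = (cx z + cy z) + (cx (- z) + cy (- z)).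
      by rewrite cxN cyN; ring.
    exact: absvD_le.
  have -> : cy z * 2%:R = (cx z + cy z) - (cx (- z) + cy (- z)).
    by rewrite cxN cyN; ring.
  exact: absvB_le.
apply: (index_double (w := conic_m1 1) (P := P) (g := fun z => h (z - g *~ j z))).
- exact: conic_m1D.
- exact: conic_tors.
- by exists 0; rewrite mulr0z subr0.
- move=> z w [i zi] [i' wi']; exists (i - i').
  by rewrite subg; exact: sB.
(* As [v] is 1 at -1, the exponent would be 0 and -1 would itself be small. *)
- move=> [i mi]; have i0 : i = 0.
    apply: (@ieexprIz _ (absv r)) => //; first by rewrite lt_eqF.
    rewrite expr0z -vg -vMz -[LHS]mul1r -[X in X * _](vsmall _ mi) -vD subrK.
    by rewrite /v !(cx_mk, cy_mk) addr0 absvN absv1.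
  by move: mi; rewrite i0 mulr0z subr0; exact: small_m1.
- move=> z w gzw; exists (j z - j w).
  have [zx zy] := coord _ (jP z); have [wx wy] := coord _ (jP w).
  by rewrite subg; exact: hP gzw.
(* P is the direct sum of the small subgroup and of the multiples of [g], so a class of P/2P is a
   class of small elements and a parity. *)
rewrite -[2%N]card_bool -[n]card_ord -card_prod.
apply: (index_is_fin (f := fun z => (odd `|e z|%N, f (z - g *~ e z)))).
  move=> [b i]; have [z sz <-] := fs i.
  have bz : small c ((z + g *~ b) - g *~ b) by rewrite addrK.
  exists (z + g *~ b); first by exists b.
  by rewrite (gP1 _ _ bz) addrK; case: b {bz}.
move=> z w Pz Pw; have sz := eP z Pz; have sw := eP w Pw; split.
  case=> odd_zw /(fe _ _ sz sw)[u su uE].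
  have [m1 m1E] := int_odd_decomp (e z); have [m2 m2E] := int_odd_decomp (e w).
  exists (u + g *~ (m1 - m2)); first by exists (m1 - m2); rewrite addrK.
  apply/eqP; rewrite addrACA -uE -subg -subr_eq -mulrzDr.
  have -> : m1 - m2 + (m1 - m2) = e z - e w.
    by rewrite [in RHS]m1E [in RHS]m2E odd_zw; ring.
  by [].
move=> [u [l ul] uE].
have zE : z - g *~ (e w + (l + l)) = (w - g *~ e w) + ((u - g *~ l) + (u - g *~ l)).
  rewrite [X in _ = _ + X]addrACA -uE -opprD [RHS]addrACA [w + _]addrC subrK.
  by rewrite -opprD -!mulrzDr.
have ezE : e z = e w + (l + l).
  apply: gP1; rewrite zE -[X in _ + X]opprK; apply: (sB _ _ sw).
  rewrite -[X in small c X]sub0r; apply: (sB _ _ s0).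
  rewrite -[X in _ + X]opprK; apply: (sB _ _ ul).
  by rewrite -[X in small c X]sub0r; exact: sB.
congr pair.
  by rewrite ezE; lia.
apply/fe => //; exists (u - g *~ l) => //.
by rewrite ezE zE [X in X - _ = _]addrC addrK.
Qed.

Lemma index_mod2_gt0 : (0 < n)%N.
Proof. by case: index_mod2 => f _; case: n f => // f; case: (f 0). Qed.

End Count.

Local Notation sqeq := (fun s t => exists r, s = t * r ^+ 2).

(** If every nonzero element were a norm, the counts for a and for 1 would agree, that is 2 n = 4 n
    with n > 0. *)
Lemma norms_proper a : a != 0 -> nonsquare a -> exists2 t, t != 0 & ~ norms a t.
Proof.
move=> a0 na; have [n nP] := index_mod2_exists two0.
apply: contrapT => all_norms.
have aE : norms a = norms 1.
  apply/seteqP; split=> t; first by case=> t0 _; apply/norms_1.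
  move=> [t0 _]; apply: contrapT => Nt; apply: all_norms; exists t => //.
have := index_split nP; rewrite -aE => /(index_unique (index_nonsquare nP a0 na)).
by have := index_mod2_gt0 nP; lia.
Qed.

(** The norm group and its coset by s are disjoint and have 2 n square classes each. Together they
    have the 4 n classes of k^*, so t is in one of them, and it is not a norm. *)
Lemma norms_index2 a s t : a != 0 -> nonsquare a -> s != 0 -> t != 0 ->
  ~ norms a s -> ~ norms a t -> norms a (s * t).
Proof.
move=> a0 na s0 t0 Ns Nt; have [n nP] := index_mod2_exists two0.
pose S : set k := norms a `|` [set u | norms a (u / s)].
have S0 u : S u -> u != 0.
  case=> [[]//|/norms_neq0]; rewrite mulf_eq0 negb_or => /andP[] //.
have disj u v r : norms a (u / s) -> norms a v -> u != v * r ^+ 2.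
  move=> Nu Nv; apply/eqP => uE; apply: Ns.
  have r0 : r != 0.
    apply: contraTneq (norms_neq0 Nu) => r0.
    by rewrite uE r0 expr0n mulr0 mul0r negbK.
  have -> : s = (v * r ^+ 2) * (u / s)^-1.
    by rewrite -uE; field; rewrite s0 uE mulf_neq0 ?expf_neq0// (norms_neq0 Nv).
  by apply: norms_mul; [exact/norms_mul_sqr | exact: norms_inv].
have [f [fs fe]] := index_nonsquare nP a0 na.
have SI : index_is S sqeq (2 * (2 * n)).
  have -> : (2 * (2 * n))%N = #|{: bool * 'I_(2 * n)}|.
    by rewrite card_prod card_bool card_ord.
  pose h u := if `[< norms a u >] then (true, f u) else (false, f (u / s)).
  apply: (index_is_fin (f := h)) => [[b i]|u v].
    have [u Nu ui] := fs i; case: b.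
      by exists u; [left | rewrite /h; case: asboolP => // _; rewrite ui].
    exists (u * s); first by right; rewrite /= mulfK.
    rewrite /h; case: asboolP => [Nus|_]; last by rewrite mulfK// ui.
    case: Ns; have -> : s = (u * s) * u^-1 by field; exact: norms_neq0 Nu.
    exact: norms_mul Nus (norms_inv Nu).
  rewrite /h => Su Sv; case: asboolP => Nu; case: asboolP => Nv.
  - by rewrite -fe//; split=> [[]|->].
  - have {Sv}Nv : norms a (v / s) by case: Sv.
    split=> // -[r uE]; have r0 : r != 0.
      apply: contraTneq (norms_neq0 Nu) => r0.
      by rewrite uE r0 expr0n mulr0 negbK.
    have := disj _ _ r^-1 Nv Nu; rewrite uE => /eqP[].
    by field.
  - have {Su}Nu : norms a (u / s) by case: Su.
    by split=> // -[r /eqP]; rewrite (negPf (disj _ _ r Nu Nv)).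
  - have {Nu Su}Nu : norms a (u / s) by case: Su.
    have {Nv Sv}Nv : norms a (v / s) by case: Sv.
    transitivity (f (u / s) = f (v / s)); first by split=> [[]|->].
    rewrite (fe _ _ Nu Nv); split=> -[r rE]; exists r.
      by rewrite -[u](divfK s0) rE; field.
    by rewrite rE mulrAC.
have S1 : S `<=` norms 1 by move=> u /S0 u0; apply/norms_1.
have T1 : norms 1 t by apply/norms_1.
have [u Su [r tE]] := index_cover S1 SI (index_split nP) T1.
have r0 : r != 0 by apply: contraTneq t0 => r0; rewrite tE r0 expr0n mulr0 negbK.
case: Su => Nu; first by case: Nt; rewrite tE; exact/norms_mul_sqr.
have -> : s * t = (u / s) * (s * r) ^+ 2 by rewrite tE; field.
by apply/norms_mul_sqr => //; rewrite mulf_neq0.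
Qed.

(* Nondegeneracy of the Hilbert symbol. *)
Lemma norms_sub_square a b : a != 0 -> nonsquare a -> b != 0 -> nonsquare b ->
  norms b `<=` norms a -> exists r, a * b = r ^+ 2.
Proof.
move=> a0 na b0 nb ba; apply: contrapT => nab.
have ab0 : a * b != 0 by rewrite mulf_neq0.
have {}nab : nonsquare (a * b) by move=> r rE; apply: nab; exists r.
have sym (c d : k) : c != 0 -> norms c d -> norms d c by exact: norms_sym.
(* By symmetry the symbol is multiplicative in its other argument: t is a norm for a and for b, so
   it is one for a b. *)
have bab : norms b `<=` norms (a * b).
  move=> t Nt; have t0 := norms_neq0 Nt.
  exact: sym (norms_mul (sym _ _ a0 (ba _ Nt)) (sym _ _ b0 Nt)).
have [t t0 Nat] := norms_proper a0 na.
have Nbt : ~ norms b t by move/ba.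
have nt : nonsquare t.
  move=> r tE; apply: Nat; rewrite tE; apply: norms_sqr.
  by apply: contraNneq t0 => r0; rewrite tE r0 expr0n.
(* Neither a nor b is a norm for t, so by index 2 their product is one. *)
have Nabt : norms (a * b) t.
  apply: (sym _ _ t0); apply: norms_index2 => // Nt.
    by apply/Nat/sym.
  by apply/Nbt/sym.
have [u u0 Nabu] := norms_proper ab0 nab.
have Nbu : ~ norms b u by move/bab.
(* Neither t nor u is a norm for b, so t u is one, hence also for a b; dividing by t makes u a norm
   for a b. *)
apply: Nabu; have -> : u = (t * u) / t by rewrite mulrAC mulfV// mul1r.
apply: norms_mul (norms_inv Nabt); apply: bab; exact: norms_index2.
Qed.

(** When |2| = 1 the ring O/2O is trivial and the norms form just two square classes: s and t both
    avoid the class of u, so they share the other one. *)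
Lemma norms_odd_residue a s t u : a != 0 -> nonsquare a ->
  odd_residue_char k -> norms a s -> norms a t -> norms a u ->
  ~ sqeq s u -> ~ sqeq t u -> sqeq s t.
Proof.
move=> a0 na k2 Ns Nt Nu nsu ntu; have [n nP] := index_mod2_exists two0.
have n1 : n = 1%N.
  case: (nP) => f [fs fe]; have f0 x : absv x <= 1 -> f x = f 0.
    by move=> x1; apply/fe => //=; rewrite ?absv0// subr0 k2.
  rewrite -[n]card_ord; apply/eqP/fintype1P; exists (f 0) => i.
  by have [x /f0 <-] := fs i.
have [f [_ fe]] := index_nonsquare nP a0 na; subst n.
apply/(fe _ _ Ns Nt); apply/val_inj.
have fsu : f s <> f u by move/(fe _ _ Ns Nu).
have ftu : f t <> f u by move/(fe _ _ Nt Nu).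
have {}fsu : f s <> f u :> nat by move=> /val_inj.
have {}ftu : f t <> f u :> nat by move=> /val_inj.
move: (f s) (f t) (f u) fsu ftu => /= [i hi] [j hj] [l hl] /=; lia.
Qed.

End NormIndex.

(** * Action on symmetric matrices *)

Section SymmetricAction.
Variable F : fieldType.
Local Notation V := 'cV[F]_3.
Implicit Types (v w : V) (g h : 'M[F]_2) (s t x y z : F).

Definition mkv x y z : V := \col_i (if i == 0 then x else if i == 1 then y else z).

Lemma xc_mkv x y z : xc (mkv x y z) = x. Proof. by rewrite /xc mxE. Qed.
Lemma yc_mkv x y z : yc (mkv x y z) = y. Proof. by rewrite /yc mxE. Qed.
Lemma zc_mkv x y z : zc (mkv x y z) = z. Proof. by rewrite /zc mxE. Qed.

Lemma xcD v w : xc (v + w) = xc v + xc w. Proof. by rewrite /xc mxE. Qed.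
Lemma ycD v w : yc (v + w) = yc v + yc w. Proof. by rewrite /yc mxE. Qed.
Lemma zcD v w : zc (v + w) = zc v + zc w. Proof. by rewrite /zc mxE. Qed.
Lemma xcN v : xc (- v) = - xc v. Proof. by rewrite /xc mxE. Qed.
Lemma ycN v : yc (- v) = - yc v. Proof. by rewrite /yc mxE. Qed.
Lemma zcN v : zc (- v) = - zc v. Proof. by rewrite /zc mxE. Qed.
Lemma xcZ a v : xc (a *: v) = a * xc v. Proof. by rewrite /xc mxE. Qed.
Lemma ycZ a v : yc (a *: v) = a * yc v. Proof. by rewrite /yc mxE. Qed.
Lemma zcZ a v : zc (a *: v) = a * zc v. Proof. by rewrite /zc mxE. Qed.

Definition coordE := (xc_mkv, yc_mkv, zc_mkv, xcD, ycD, zcD, xcN, ycN, zcN,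
  xcZ, ycZ, zcZ).

Lemma coord_eq v w : xc v = xc w -> yc v = yc w -> zc v = zc w -> v = w.
Proof.
rewrite /xc /yc /zc => h0 h1 h2; apply/colP => i.
case: i => [[|[|[|//]]]] /= p.
- by rewrite (_ : Ordinal p = 0) //; exact/val_inj.
- by rewrite (_ : Ordinal p = 1) //; exact/val_inj.
- by rewrite (_ : Ordinal p = 2%:R) //; exact/val_inj.
Qed.

Lemma coord_eq0 v : (v == 0) = [&& xc v == 0, yc v == 0 & zc v == 0].
Proof.
apply/eqP/and3P => [->|[/eqP h0 /eqP h1 /eqP h2]].
  by rewrite /xc /yc /zc !mxE eqxx.
by apply: coord_eq; rewrite ?h0 ?h1 ?h2 /xc /yc /zc mxE.
Qed.

Definition mk2 p q r s : 'M[F]_2 := \matrix_(i, j)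
  (if i == 0 then if j == 0 then p else q else if j == 0 then r else s).

Lemma mk2E p q r s : ((mk2 p q r s 0 0 = p) * (mk2 p q r s 0 1 = q) *
  (mk2 p q r s 1 0 = r) * (mk2 p q r s 1 1 = s))%type.
Proof. by rewrite !mxE. Qed.

Lemma det2 g : \det g = g 0 0 * g 1 1 - g 0 1 * g 1 0.
Proof.
have e1 : lift ord0 ord0 = 1 :> 'I_2 by exact/val_inj.
have e2 : lift 1 0 = 0 :> 'I_2 by exact/val_inj.
have e0 : ord0 = 0 :> 'I_2 by [].
rewrite (expand_det_row _ 0) !big_ord_recl big_ord0 /cofactor !det_mx11 !mxE.
by rewrite /= e1 e2 e0 addn0 expr0 expr1; ring.
Qed.

Lemma unit2 g : (g \in unitmx) = (g 0 0 * g 1 1 - g 0 1 * g 1 0 != 0).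
Proof. by rewrite unitmxE det2 unitfE. Qed.

Definition rho g : 'M[F]_3 := \det g *: Ad_mx g.

Lemma rho_mul_vec g v : g \in unitmx -> rho g *m v = mkv
  (g 0 0 ^+ 2 * xc v + 2%:R * g 0 0 * g 0 1 * yc v + g 0 1 ^+ 2 * zc v)
  (g 0 0 * g 1 0 * xc v + (g 0 0 * g 1 1 + g 0 1 * g 1 0) * yc v
     + g 0 1 * g 1 1 * zc v)
  (g 1 0 ^+ 2 * xc v + 2%:R * g 1 0 * g 1 1 * yc v + g 1 1 ^+ 2 * zc v).
Proof.
rewrite unitmxE unitfE => dg; rewrite /rho -scalemxAl Ad_mxE.
have S00 : symmx v 0 0 = xc v by rewrite mxE.
have S01 : symmx v 0 1 = yc v by rewrite mxE.
have S10 : symmx v 1 0 = yc v by rewrite mxE.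
have S11 : symmx v 1 1 = zc v by rewrite mxE.
have e1 : lift ord0 ord0 = 1 :> 'I_2 by exact/val_inj.
have e0 n : ord0 = 0 :> 'I_n.+1 by [].
have entry i j : (\det g *: ((\det g)^-1 *: (g *m symmx v *m g^T))) i j =
    (g i 0 * xc v + g i 1 * yc v) * g j 0 + (g i 0 * yc v + g i 1 * zc v) * g j 1.
  rewrite scalerA divff// scale1r !mxE !big_ord_recl big_ord0 e1 !e0.
  rewrite !mxE !big_ord_recl !big_ord0 e1 !e0 S00 S01 S10 S11.
  by ring.
have vs (a : F) (S : 'M[F]_2) :
    a *: vec_sym S = mkv ((a *: S) 0 0) ((a *: S) 0 1) ((a *: S) 1 1).
  by apply: coord_eq; rewrite !coordE /xc /yc /zc !mxE.
by rewrite /Ad vs !entry; apply: coord_eq; rewrite !coordE; ring.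
Qed.

Lemma mx_eq_on_vec (A B : 'M[F]_3) : (forall v, A *m v = B *m v) -> A = B.
Proof.
by move=> AB; apply/matrixP => i j; have /colP/(_ i) := AB (delta_mx j 0);
  rewrite -!colE !mxE.
Qed.

Lemma rhoM g h : g \in unitmx -> h \in unitmx -> rho (g *m h) = rho g *m rho h.
Proof.
move=> gu hu; apply: mx_eq_on_vec => v.
have ghu : g *m h \in unitmx by rewrite unitmx_mul gu.
have e1 : lift ord0 ord0 = 1 :> 'I_2 by exact/val_inj.
have E i j : (g *m h) i j = g i 0 * h 0 j + g i 1 * h 1 j.
  by rewrite mxE !big_ord_recl big_ord0 e1 addr0.
rewrite -mulmxA !rho_mul_vec// !E.
by apply: coord_eq; rewrite !coordE; ring.
Qed.

Lemma rho1 : rho 1%:M = 1%:M.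
Proof.
apply: mx_eq_on_vec => v; rewrite rho_mul_vec ?unitmx1// mul1mx.
by apply: coord_eq; rewrite !coordE !mxE /=; ring.
Qed.

Lemma rhoK g : g \in unitmx -> rho g *m rho (invmx g) = 1%:M.
Proof. by move=> gu; rewrite -rhoM ?unitmx_inv// mulmxV// rho1. Qed.

Lemma rhoVK g : g \in unitmx -> rho (invmx g) *m rho g = 1%:M.
Proof. by move=> gu; rewrite -rhoM ?unitmx_inv// mulVmx// rho1. Qed.

Lemma rho_unit g : g \in unitmx -> rho g \in unitmx.
Proof. by move=> /rhoK/mulmx1_unit[]. Qed.

Lemma rhoZ s g : s != 0 -> g \in unitmx -> rho (s *: g) = s ^+ 2 *: rho g.
Proof.
move=> s0 gu; apply: mx_eq_on_vec => v.
have sgu : s *: g \in unitmx by rewrite unitmxZ ?unitfE.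
rewrite -scalemxAl !rho_mul_vec//.
by apply: coord_eq; rewrite !coordE !mxE; ring.
Qed.

Hypothesis two0 : (2%:R : F) != 0.

Lemma BE v w : B v w = xc v * zc w + zc v * xc w - 2%:R * yc v * yc w.
Proof. by rewrite /B /Q !coordE; field. Qed.

Lemma Bvv v : B v v = 2%:R * Q v.
Proof. by rewrite BE /Q; ring. Qed.

Lemma BDr u v w : B u (v + w) = B u v + B u w.
Proof. by rewrite !BE !coordE; ring. Qed.

Lemma BZr a v w : B v (a *: w) = a * B v w.
Proof. by rewrite !BE !coordE; ring. Qed.

Lemma BZl a v w : B (a *: v) w = a * B v w.
Proof. by rewrite !BE !coordE; ring. Qed.

Lemma QZ a v : Q (a *: v) = a ^+ 2 * Q v.
Proof. by rewrite /Q !coordE; ring. Qed.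

Lemma QD v w : Q (v + w) = Q v + B v w + Q w.
Proof. by rewrite BE /Q !coordE; ring. Qed.

Lemma Q_rho g v : g \in unitmx -> Q (rho g *m v) = \det g ^+ 2 * Q v.
Proof. by move=> gu; rewrite rho_mul_vec// /Q det2 !coordE; ring. Qed.

Lemma B_rho g v w : g \in unitmx ->
  B (rho g *m v) (rho g *m w) = \det g ^+ 2 * B v w.
Proof. by move=> gu; rewrite !rho_mul_vec// !BE det2 !coordE; ring. Qed.

(** The cone consists of the rank one matrices u u^T, with u = (s, t); the sign of s is adjusted so
    that s t is the middle coordinate. In this form [rho] g acts linearly on (s, t). *)
Lemma cone1P v : cone1 v <->
  exists s t, (s != 0 \/ t != 0) /\ v = mkv (s ^+ 2) (s * t) (t ^+ 2).
Proof.
split=> [[v0 xz [s xs] [t zt]]|[s [t [st ->]]]].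
  have [s' [s's ys]] : exists s', s' ^+ 2 = s ^+ 2 /\ yc v = s' * t.
    have /eqP : yc v ^+ 2 = (s * t) ^+ 2 by rewrite -xz xs zt; ring.
    rewrite eqf_sqr => /orP[] /eqP yE; first by exists s.
    by exists (- s); rewrite sqrrN mulNr.
  exists s', t; split; last first.
    by apply: coord_eq; rewrite !coordE ?s's.
  apply/orP; rewrite -negb_and; apply: contra v0 => /andP[/eqP s0 /eqP t0].
  by rewrite coord_eq0 xs ys zt -s's s0 t0 expr0n mulr0 eqxx.
split; rewrite ?coordE.
- by rewrite coord_eq0 !coordE !sqrf_eq0; case: st => /negPf ->; rewrite ?andbF.
- by ring.
- by exists s.
- by exists t.
Qed.

Lemma cone1_rho g v : g \in unitmx -> cone1 v -> cone1 (rho g *m v).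
Proof.
move=> gu /cone1P[s [t [st ->]]]; apply/cone1P.
exists (g 0 0 * s + g 0 1 * t), (g 1 0 * s + g 1 1 * t); split; last first.
  by rewrite rho_mul_vec//; apply: coord_eq; rewrite !coordE; ring.
apply/orP; rewrite -negb_and; apply/negP => /andP[/eqP h0 /eqP h1].
move: gu; rewrite unit2 => d0.
have s0 : s = 0.
  apply: (mulfI d0); rewrite mulr0; transitivity
    (g 1 1 * (g 0 0 * s + g 0 1 * t) - g 0 1 * (g 1 0 * s + g 1 1 * t)); first by ring.
  by rewrite h0 h1; ring.
have t0 : t = 0.
  apply: (mulfI d0); rewrite mulr0; transitivity
    (g 0 0 * (g 1 0 * s + g 1 1 * t) - g 1 0 * (g 0 0 * s + g 0 1 * t)); first by ring.
  by rewrite h0 h1; ring.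
by case: st; rewrite ?s0 ?t0 eqxx.
Qed.

Lemma isotropic_cone v : v != 0 -> Q v = 0 ->
  exists2 l, l != 0 & exists2 w, cone1 w & v = l *: w.
Proof.
move=> v0 /eqP; rewrite /Q subr_eq0 => /eqP Qv.
have [x0|x0] := eqVneq (xc v) 0; last first.
  exists (xc v) => //; exists (mkv (1 ^+ 2) (1 * (yc v / xc v)) ((yc v / xc v) ^+ 2)).
    by apply/cone1P; exists 1, (yc v / xc v); rewrite oner_neq0; split; [left|].
  apply: coord_eq; rewrite !coordE; [by rewrite expr1n mulr1 | by field |].
  by rewrite expr_div_n -Qv; field.
have y0 : yc v = 0.
  by apply/eqP; rewrite -sqrf_eq0 -Qv x0 mul0r.
have z0 : zc v != 0.
  by apply: contra v0 => z0; rewrite coord_eq0 x0 y0 z0 eqxx.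
exists (zc v) => //; exists (mkv (0 ^+ 2) (0 * 1) (1 ^+ 2)).
  by apply/cone1P; exists 0, 1; rewrite oner_neq0; split; [right|].
by apply: coord_eq; rewrite !coordE ?x0 ?y0; ring.
Qed.

End SymmetricAction.

(** * Orbits on the disc *)

Section Disc.
Variables (R : realType) (k : nonArchLocalFieldType R).
Hypothesis two0 : (2%:R : k) != 0.
Variable al : k.
Hypotheses (al0 : al != 0) (nal : nonsquare (- al)).
Local Notation V := 'cV[k]_3.
Local Notation N := (norms (- al)).
Local Notation H := (H_ (sqclass al)).
Implicit Types (u v w : V) (g h : 'M[k]_2) (M : 'M[k]_3) (s t x y z : k).

Let Nal0 : - al != 0. Proof. by rewrite oppr_eq0. Qed.

Lemma norm_form_eq0 x y : x ^+ 2 + al * y ^+ 2 = 0 -> x = 0 /\ y = 0.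
Proof.
move=> xy; have [y0|y0] := eqVneq y 0.
  by move: xy; rewrite y0 expr0n mulr0 addr0 => /eqP; rewrite sqrf_eq0 => /eqP.
case: (nal (r := x / y)); rewrite expr_div_n.
have -> : x ^+ 2 = - (al * y ^+ 2) by apply/eqP; rewrite -addr_eq0 xy.
by field.
Qed.

Lemma norms_form x y : x != 0 \/ y != 0 -> N (x ^+ 2 + al * y ^+ 2).
Proof.
move=> xy; split; last by exists x, y; ring.
by apply/eqP => /norm_form_eq0[x0 y0]; case: xy; rewrite ?x0 ?y0 eqxx.
Qed.

Lemma N1 : N 1.
Proof. by rewrite -(expr1n _ 2); apply: norms_sqr; exact: oner_neq0. Qed.

(* Every norm is a value of the form at a vector with nonzero coordinates: turn a
   vector on an axis by the norm one element of parameter s. *)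
Lemma K_norms : K_ (sqclass al) = N.
Proof.
apply/seteqP; split=> [t [t0 [_ [x [y [[u u0 <-] x0 y0 tE]]]]]|t [t0 [y [x tE]]]].
  by split=> //; exists y, (u * x); rewrite tE; ring.
split=> //.
(* These conditions make both coordinates of the norm one element nonzero. The parameter 1 fails
   only for al = 1, where any nonzero s with |s| < 1 will do. *)
have [s s0 s1] : exists2 s, s != 0 & 1 - al * s ^+ 2 != 0.
  have [e1|e1] := eqVneq (1 - al * 1 ^+ 2) 0; last by exists 1; rewrite ?oner_neq0.
  have [r [r0 r1]] := exists_absv_lt1 k; exists r => //.
  have -> : al = 1.
    apply/eqP; rewrite -[al]mulr1 -[X in al * X](expr1n _ 2) eq_sym.
    by rewrite -subr_eq0 e1.
  rewrite mul1r subr_eq0; apply/eqP => rE.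
  have := congr1 absv rE; rewrite absv1 absvX => /eqP.
  by rewrite eq_sym sqrp_eq1 ?absv_ge0// lt_eqF.
have d0 : 1 + al * s ^+ 2 != 0.
  have /norms_neq0 := @norms_form 1 s (or_introl (oner_neq0 _)).
  by rewrite expr1n.
have alc : sqclass al al by exists 1; rewrite /kstar /= ?oner_neq0// expr1n mulr1.
have axis x' y' (p := (1 - al * s ^+ 2) / (1 + al * s ^+ 2))
    (q := 2%:R * s / (1 + al * s ^+ 2)) :
    t = y' ^+ 2 + al * x' ^+ 2 ->
    t = al * (p * x' + q * y') ^+ 2 + (p * y' - al * q * x') ^+ 2.
  by move=> ->; rewrite /p /q; field.
have tE' : t = y ^+ 2 + al * x ^+ 2 by rewrite tE; ring.
have [x0|x0] := eqVneq x 0; last have [y0|y0] := eqVneq y 0.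
- have y0 : y != 0.
    by apply: contraNneq t0 => y0; rewrite tE' x0 y0 expr0n mulr0 addr0.
  exists al; eexists; eexists; split; [by [] | | | exact: (axis _ _ tE')].
    by rewrite x0 mulr0 add0r !mulf_neq0 ?invr_eq0.
  by rewrite x0 mulr0 subr0 !mulf_neq0 ?invr_eq0.
- exists al; eexists; eexists; split; [by [] | | | exact: (axis _ _ tE')].
    by rewrite y0 mulr0 addr0 !mulf_neq0 ?invr_eq0.
  by rewrite y0 mulr0 sub0r oppr_eq0 !mulf_neq0 ?invr_eq0.
- by exists al, x, y; split=> //; rewrite tE' addrC.
Qed.

(** Pairing v with the cone vector of parameters (s, t) evaluates the binary form of the matrix v at
    (t, -s). *)
Lemma H_form v : H v <-> forall s t, s != 0 \/ t != 0 ->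
  N (xc v * t ^+ 2 - 2%:R * yc v * (s * t) + zc v * s ^+ 2).
Proof.
rewrite /H_ K_norms /=; split=> [Hv s t st|Hv w /cone1P[s [t [st ->]]]].
  have := Hv (mkv (s ^+ 2) (s * t) (t ^+ 2)); rewrite BE// !coordE.
  have -> : xc v * t ^+ 2 - 2%:R * yc v * (s * t) + zc v * s ^+ 2 =
    xc v * t ^+ 2 + zc v * s ^+ 2 - 2%:R * yc v * (s * t) by ring.
  by apply; apply/cone1P; exists s, t.
rewrite BE// !coordE.
have -> : xc v * t ^+ 2 + zc v * s ^+ 2 - 2%:R * yc v * (s * t) =
  xc v * t ^+ 2 - 2%:R * yc v * (s * t) + zc v * s ^+ 2 by ring.
exact: Hv.
Qed.

(** Both directions complete the square: with x = [xc v] and y = [yc v], x times the binary form is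
    (x t - y s)^2 + Q s^2. Thus the norms of k(sqrt(-Q)) are in K when v is in H, and
    [norms_sub_square] gives the class of Q. *)
Lemma H_char v : H v <-> N (xc v) /\ exists2 d, d != 0 & Q v = al * d ^+ 2.
Proof.
split=> [/H_form Hv|[Nx [d d0 QE]]].
  have Nx : N (xc v).
    have := Hv 0 1 (or_intror (oner_neq0 _)).
    by rewrite expr0n expr1n mul0r !mulr0 subr0 addr0 mulr1.
  have x0 := norms_neq0 Nx.
  have form X Y : X != 0 \/ Y != 0 -> N (X ^+ 2 + Q v * Y ^+ 2).
    move=> XY; pose t := (X + yc v * Y) / xc v.
    have -> : X ^+ 2 + Q v * Y ^+ 2 = xc v *
        (xc v * t ^+ 2 - 2%:R * yc v * (Y * t) + zc v * Y ^+ 2).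
      by rewrite /t /Q; field.
    apply: norms_mul => //; apply: Hv.
    have [Y0|] := eqVneq Y 0; last by left.
    right; rewrite /t Y0 mulr0 addr0 mulf_neq0 ?invr_eq0//.
    by case: XY => //; rewrite Y0 eqxx.
  have nQ : nonsquare (- Q v).
    move=> r rE; have /norms_neq0 := form r 1 (or_intror (oner_neq0 _)).
    by rewrite -rE expr1n mulr1 addNr eqxx.
  have Q0 : - Q v != 0 by apply/eqP => Q0; apply: (nQ 0); rewrite Q0 expr0n.
  split=> //.
  have [|r rE] := norms_sub_square two0 Nal0 nal Q0 nQ.
    move=> u [u0 [X [Y uE]]]; rewrite uE.
    have -> : X ^+ 2 - - Q v * Y ^+ 2 = X ^+ 2 + Q v * Y ^+ 2 by ring.
    apply: form; apply/orP; rewrite -negb_and; apply: contra u0 => /andP[/eqP X0 /eqP Y0].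
    by rewrite uE X0 Y0 expr0n mulr0 subr0.
  have r0 : r != 0.
    by rewrite -sqrf_eq0 -rE mulf_neq0.
  exists (r / al); first by rewrite mulf_neq0 ?invr_eq0.
  by rewrite expr_div_n -rE; field.
apply/H_form => s t st; have x0 := norms_neq0 Nx.
have -> : xc v * t ^+ 2 - 2%:R * yc v * (s * t) + zc v * s ^+ 2 =
    ((xc v * t - yc v * s) ^+ 2 + al * (d * s) ^+ 2) * (xc v)^-1.
  have -> : al * (d * s) ^+ 2 = Q v * s ^+ 2 by rewrite QE; ring.
  by rewrite /Q; field.
apply: norms_mul (norms_inv Nx); apply: norms_form.
have [s0|s0] := eqVneq s 0; last by right; rewrite mulf_neq0.
left; rewrite s0 mulr0 subr0 mulf_neq0//.
by case: st => //; rewrite s0 eqxx.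
Qed.

Lemma H_neq0 v : H v -> v != 0.
Proof.
move=> /H_char[/norms_neq0 x0 _]; apply: contraNneq x0 => ->.
by rewrite /xc mxE.
Qed.

Lemma H_scale c v : N c -> H v -> H (c *: v).
Proof.
move=> Nc /H_char[Nx [d d0 QE]]; apply/H_char; rewrite xcZ QZ.
split; first exact: norms_mul.
exists (c * d); first by rewrite mulf_neq0// (norms_neq0 Nc).
by rewrite QE; ring.
Qed.

Lemma H_rho g v : g \in unitmx -> H v -> H (rho g *m v).
Proof.
move=> gu /H_form Hv; apply/H_form => s t st.
rewrite rho_mul_vec// !coordE.
(* The form g S g^T at (t, -s) is the form S at g^T (t, -s) = (t', -s'). *)
pose s' := g 1 1 * s - g 0 1 * t; pose t' := g 0 0 * t - g 1 0 * s.
have := Hv s' t'; rewrite /s' /t'.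
set X := (X in N X); set Y := (Y in _ -> N Y).
have -> : X = Y by rewrite /X /Y; ring.
apply; move: gu; rewrite unit2 => d0.
apply/orP; rewrite -negb_and; apply/negP => /andP[/eqP h0 /eqP h1].
have s0 : s = 0.
  apply: (mulfI d0); rewrite mulr0; transitivity
    (g 0 0 * (g 1 1 * s - g 0 1 * t) + g 0 1 * (g 0 0 * t - g 1 0 * s)); first by ring.
  by rewrite h0 h1; ring.
have t0 : t = 0.
  apply: (mulfI d0); rewrite mulr0; transitivity
    (g 1 0 * (g 1 1 * s - g 0 1 * t) + g 1 1 * (g 0 0 * t - g 1 0 * s)); first by ring.
  by rewrite h0 h1; ring.
by case: st; rewrite ?s0 ?t0 eqxx.
Qed.

Definition vbase : V := mkv 1 0 al.

Lemma H_vbase : H vbase.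
Proof.
apply/H_char; rewrite /Q !coordE; split; first exact: N1.
by exists 1; rewrite ?oner_neq0//; ring.
Qed.

(** The square is completed by a lower triangular matrix, as in a Cholesky decomposition, the factor
    in K being the first coordinate. *)
Lemma H_orbit v : H v -> exists g c,
  [/\ g \in unitmx, N c & v = c *: (rho g *m vbase)].
Proof.
move=> /H_char[Nx [d d0 QE]]; have x0 := norms_neq0 Nx.
have gu : mk2 1 0 (yc v / xc v) (d / xc v) \in unitmx.
  by rewrite unit2 !mk2E mul0r subr0 mul1r mulf_neq0 ?invr_eq0.
exists (mk2 1 0 (yc v / xc v) (d / xc v)), (xc v); split=> //.
rewrite rho_mul_vec//; apply: coord_eq; rewrite !coordE !mk2E; first by ring.
  by field.
have -> : zc v = (Q v + yc v ^+ 2) / xc v by rewrite /Q; field.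
by rewrite QE; field.
Qed.

(** These are the matrices of multiplication by elements of k(sqrt(-al)), which are similitudes of
    diag(1, al) with factor the norm. *)
Lemma vbase_stab p q : p != 0 \/ q != 0 -> exists c,
  [/\ mk2 p (- q) (al * q) p \in unitmx, N c &
      rho (mk2 p (- q) (al * q) p) *m vbase = c *: vbase].
Proof.
move=> pq; have Nc := norms_form pq.
have gu : mk2 p (- q) (al * q) p \in unitmx.
  rewrite unit2 !mk2E; have := norms_neq0 Nc.
  by have -> : p * p - - q * (al * q) = p ^+ 2 + al * q ^+ 2 by ring.
exists (p ^+ 2 + al * q ^+ 2); split=> //.
by rewrite rho_mul_vec//; apply: coord_eq; rewrite !coordE !mk2E; ring.
Qed.

Lemma disc_cone_orbit v w : H v -> cone1 w -> exists g c,
  [/\ g \in unitmx, N c, rho g *m vbase = c *: v &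
      rho g *m mkv 1 0 0 = w].
Proof.
move=> /H_orbit[g [c [gu Nc vE]]] cw.
have gVu : invmx g \in unitmx by rewrite unitmx_inv.
have /cone1P[s [t [st w'E]]] := cone1_rho gVu cw.
(* With q = t/al the matrix of [vbase_stab] has first column (s, t), so it sends the cone vector of
   parameters (1, 0) to that of parameters (s, t). *)
have st' : s != 0 \/ t / al != 0.
  by case: st => h; [left|right; rewrite mulf_neq0// invr_eq0].
have [c' [eu Nc' eE]] := vbase_stab st'.
exists (g *m mk2 s (- (t / al)) (al * (t / al)) s), (c' / c); split.
- by rewrite unitmx_mul gu.
- exact: norms_mul (norms_inv Nc).
- rewrite rhoM// -mulmxA eE -scalemxAr vE scalerA divfK//.
  exact: norms_neq0 Nc.
- rewrite rhoM// -mulmxA.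
  have -> : rho (mk2 s (- (t / al)) (al * (t / al)) s) *m mkv 1 0 0 =
      rho (invmx g) *m w.
    rewrite w'E rho_mul_vec//; apply: coord_eq; rewrite !coordE !mk2E.
    - by ring.
    - by field.
    - by field.
  by rewrite mulmxA rhoK// mul1mx.
Qed.

(* The orthogonal of vbase is k(sqrt(-al)), w being seen as zeta = y + x sqrt(-al);
   the stabilizer acts there by multiplication by u^2, for u = p - q sqrt(-al). The
   choice u = (zeta + zeta') * conj(zeta) of Hilbert 90 sends the line of zeta to the
   line of zeta'. *)
Lemma vbase_orth_orbit w w' r : B vbase w = 0 -> B vbase w' = 0 ->
  w != 0 -> w' != 0 -> Q w = Q w' * r ^+ 2 ->
  exists g c l, [/\ g \in unitmx, N c, rho g *m vbase = c *: vbase,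
                  l != 0 & rho g *m w = l *: w'].
Proof.
have orth u : B vbase u = 0 -> zc u = - (al * xc u).
  rewrite BE// !coordE => /eqP; rewrite mul1r mulr0 mul0r subr0 addr_eq0.
  by move=> /eqP.
have neq0 u : B vbase u = 0 -> u != 0 -> yc u != 0 \/ xc u != 0.
  move=> /orth zE u0; apply/orP; rewrite -negb_and.
  apply: contra u0 => /andP[/eqP y0 /eqP x0].
  by rewrite coord_eq0 zE x0 y0 mulr0 oppr0 eqxx.
wlog -> : w' r / r = 1 => [wl|] ow ow' w0 w'0 QE.
  have r0 : r != 0.
    apply: contraNneq (norms_neq0 (norms_form (neq0 _ ow w0))) => r0.
    apply/eqP; transitivity (- Q w); last by rewrite QE r0 expr0n mulr0 oppr0.
    by rewrite /Q (orth _ ow); ring.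
  have [||||g [c [l [gu Nc gv l0 gw]]]] := wl (r *: w') 1 erefl ow.
  - by rewrite BZr// ow' mulr0.
  - by [].
  - by rewrite scaler_eq0 negb_or r0.
  - by rewrite QE QZ; ring.
  exists g, c, (l * r); split=> //; first by rewrite mulf_neq0.
  by rewrite gw scalerA.
have zE := orth _ ow; have zE' := orth _ ow'.
have QE' : al * xc w ^+ 2 + yc w ^+ 2 = al * xc w' ^+ 2 + yc w' ^+ 2.
  transitivity (- Q w); first by rewrite /Q zE; ring.
  by rewrite QE /Q zE'; ring.
(* Here the Hilbert 90 element vanishes, but w and w' already span the same line. *)
have [ww|ww] := eqVneq (w + w') 0.
  exists 1%:M, 1, (-1); rewrite unitmx1 rho1 !mul1mx scale1r oppr_eq0 oner_neq0.
  split=> //; first exact: N1.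
  by rewrite scaleN1r; apply/eqP; rewrite -addr_eq0 ww.
pose p := (yc w + yc w') * yc w + al * (xc w + xc w') * xc w.
pose q := - (xc w' * yc w - yc w' * xc w).
have pqE : p ^+ 2 + al * q ^+ 2 =
   ((yc w + yc w') ^+ 2 + al * (xc w + xc w') ^+ 2) * (yc w ^+ 2 + al * xc w ^+ 2).
  by rewrite /p /q; ring.
have ow2 : B vbase (w + w') = 0 by rewrite BDr// ow ow' addr0.
have pq0 : p ^+ 2 + al * q ^+ 2 != 0.
  rewrite pqE mulf_neq0 ?(norms_neq0 (norms_form (neq0 _ ow w0)))//.
  by have := norms_neq0 (norms_form (neq0 _ ow2 ww)); rewrite !coordE.
have pq : p != 0 \/ q != 0.
  apply/orP; rewrite -negb_and; apply: contra pq0 => /andP[/eqP -> /eqP ->].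
  by rewrite expr0n mulr0 addr0.
have [c [gu Nc gE]] := vbase_stab pq.
exists (mk2 p (- q) (al * q) p), c, (p ^+ 2 + al * q ^+ 2); split=> //.
(* Each coordinate identity holds modulo the relation D = 0; the cofactor of D is supplied
   explicitly. *)
pose D := al * xc w ^+ 2 + yc w ^+ 2 - (al * xc w' ^+ 2 + yc w' ^+ 2).
have D0 : D = 0 by rewrite /D QE' subrr.
pose n := yc w ^+ 2 + al * xc w ^+ 2.
have eqD m a b : a - b = m * D -> a = b.
  by rewrite D0 mulr0 => /eqP; rewrite subr_eq0 => /eqP.
rewrite rho_mul_vec//; apply: coord_eq; rewrite !coordE !mk2E ?zE ?zE'.
- by apply: (eqD ((xc w + xc w') * n)); rewrite /D /n /p /q; ring.
- by apply: (eqD ((yc w + yc w') * n)); rewrite /D /n /p /q; ring.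
- by apply: (eqD (- al * (xc w + xc w') * n)); rewrite /D /n /p /q; ring.
Qed.

Lemma flag_orbit v v' w w' r : H v -> H v' -> B v w = 0 -> B v' w' = 0 ->
  w != 0 -> w' != 0 -> Q w = Q w' * r ^+ 2 ->
  exists g c l, [/\ g \in unitmx, N c, rho g *m v = c *: v',
                  l != 0 & rho g *m w = l *: w'].
Proof.
move=> /H_orbit[h [c [hu Nc vE]]] /H_orbit[h' [c' [hu' Nc' vE']]] ow ow' w0 w0' QE.
have c0 := norms_neq0 Nc; have c0' := norms_neq0 Nc'.
have hVu : invmx h \in unitmx by rewrite unitmx_inv.
have hVu' : invmx h' \in unitmx by rewrite unitmx_inv.
have dets g : g \in unitmx -> \det g != 0 by rewrite unitmxE unitfE.
have orth g d a u : g \in unitmx -> N d -> a = d *: (rho g *m vbase) ->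
    B a u = 0 -> B vbase (rho (invmx g) *m u) = 0.
  move=> gu Nd aE /eqP; rewrite aE BZl// mulf_eq0 (negPf (norms_neq0 Nd)) /=.
  rewrite -[u in B _ u]mul1mx -(rhoK gu) -mulmxA B_rho// mulf_eq0 sqrf_eq0.
  by rewrite (negPf (dets _ gu)) => /eqP.
have neq0 g u : g \in unitmx -> u != 0 -> rho g *m u != 0.
  move=> gu; apply: contra => /eqP gu0.
  by rewrite -[u]mul1mx -(rhoVK gu) -mulmxA gu0 mulmx0.
(* Going back to the base point multiplies Q by the square of a determinant, which only changes
   r. *)
have [] := @vbase_orth_orbit (rho (invmx h) *m w) (rho (invmx h') *m w')
  (\det (invmx h) / \det (invmx h') * r).
- exact: orth vE ow.
- exact: orth vE' ow'.
- exact: neq0.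
- exact: neq0.
- by rewrite !Q_rho// QE; field; exact: dets.
move=> g [d [l [gu Nd gv l0 gw]]].
exists (h' *m g *m invmx h), (c * d / c'), l; split=> //.
- by rewrite !unitmx_mul hu' gu hVu.
- by apply: norms_mul (norms_inv Nc'); exact: norms_mul.
- rewrite !rhoM ?unitmx_mul ?hu'// vE -scalemxAr -!mulmxA.
  rewrite [rho (invmx h) *m _]mulmxA rhoVK// mul1mx gv -scalemxAr vE' !scalerA.
  by rewrite divfK.
- rewrite !rhoM ?unitmx_mul ?hu'// -!mulmxA gw -scalemxAr mulmxA rhoK//.
  by rewrite mul1mx.
Qed.

End Disc.

(** * Linear maps preserving the disc *)

Section Isometries.
Variables (R : realType) (k : nonArchLocalFieldType R).
Hypothesis two0 : (2%:R : k) != 0.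
Variable al : k.
Hypotheses (al0 : al != 0) (nal : nonsquare (- al)).
Local Notation V := 'cV[k]_3.
Local Notation N := (norms (- al)).
Local Notation H := (H_ (sqclass al)).
Implicit Types (u v w : V) (g h : 'M[k]_2) (M : 'M[k]_3) (s t x y z : k).

(** One t serves for both factors, since membership in H depends on Q and on the first coordinate at
    the same time. *)
Lemma small_perturb_square (a b c : k) : exists2 t, t != 0 &
  (exists2 s, s != 0 & s ^+ 2 = 1 + t ^+ 2 * a + t ^+ 4 * b) /\
  (exists2 s, s != 0 & s ^+ 2 = 1 + t ^+ 2 * c).
Proof.
have [d0 d00 d0P] := squares_open two0.
pose d := Num.min d0 2%:R^-1.
have d_gt0 : 0 < d by rewrite lt_min d00 invr_gt0 ltr0n.
have d_lt1 : d < 1 by rewrite gt_min invf_lt1 ?ltr0n// ltr1n orbT.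
pose m := 1 + absv a + absv b + absv c.
have m0 : 0 < m by rewrite /m !ltr_wpDr ?absv_ge0.
have e0 : 0 < Num.min 1 (d / m) by rewrite lt_min ltr01 divr_gt0.
have [t t0] := @exists_small R k _ e0; rewrite lt_min => /andP[t1 tm].
have tX n : (0 < n)%N -> absv (t ^+ n) <= absv t.
  case: n => // n _; rewrite absvX exprS ler_piMr ?absv_ge0//.
  by rewrite exprn_ile1 ?absv_ge0 ?ltW.
have le x n : (0 < n)%N -> absv x <= m -> absv (t ^+ n * x) <= d.
  move=> n0 xm; rewrite absvM -[d](divfK (lt0r_neq0 m0)).
  by rewrite ler_pM ?absv_ge0// (le_trans (tX _ n0))// ltW.
have [am [bm cm]] : absv a <= m /\ absv b <= m /\ absv c <= m.
  have := absv_ge0 a; have := absv_ge0 b; have := absv_ge0 c.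
  by rewrite /m; split; [|split]; lra.
have sq (e : k) : absv e <= d -> exists2 s, s != 0 & s ^+ 2 = 1 + e.
  move=> ed; have [|s sE] := d0P e.
    by rewrite (le_trans ed)// ge_min lexx.
  exists s => //; have : s ^+ 2 != 0.
    by rewrite sE -absv_gt0 addrC absvD_eq absv1 ?ltr01// (le_lt_trans ed).
  by rewrite sqrf_eq0.
exists t => //; split; last by apply: sq; exact: le.
by rewrite -addrA; apply: sq; apply: absvD_le; exact: le.
Qed.

Section Classification.
Variable M : 'M[k]_3.
Hypotheses (Mu : M \in unitmx) (MH : forall v, H v -> H (M *m v))
  (MHV : forall v, H (M *m v) -> H v).

(** If Q (M v) were nonzero, a small perturbation in H would have the same square classes of Q and
    of the first coordinate as M v. Then M v, and hence v, would be in H, against Q v = 0. *)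
Lemma isom_cone v : cone1 v -> Q (M *m v) = 0.
Proof.
move=> cv; apply: contrapT => /eqP Qf0.
have [g [c [gu Nc _ gE]]] := disc_cone_orbit two0 al0 nal (H_vbase two0 al0 nal) cv.
(* The perturbation comes from (1, 0, al t^2), which is in H for all nonzero t, moved by g so that
   (1, 0, 0) goes to v. *)
pose f := M *m v; pose h := M *m (rho g *m mkv 0 0 al).
have Hfh t : t != 0 -> H (f + t ^+ 2 *: h).
  move=> t0; have : H (mkv 1 0 0 + t ^+ 2 *: mkv 0 0 al).
    apply/(H_char two0 al0 nal); rewrite /Q !coordE; split.
      by rewrite mulr0 addr0; exact: N1.
    by exists t => //; ring.
  move=> /(H_rho two0 al0 nal gu)/MH.
  by rewrite !mulmxDr gE -!scalemxAr.
have Qfh t : Q (f + t ^+ 2 *: h) = Q f + t ^+ 2 * B f h + t ^+ 4 * Q h.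
  by rewrite QD// BZr// QZ; ring.
have [t t0 [[s s0 sE] [s' s'0 s'E]]] :=
  small_perturb_square (B f h / Q f) (Q h / Q f) (xc h / xc f).
have /(H_char two0 al0 nal)[Nx [d d0 QE]] := Hfh t t0.
have QfE : Q f = al * (d / s) ^+ 2.
  have : Q f * s ^+ 2 = al * d ^+ 2 by rewrite sE -QE Qfh; field.
  by move=> E; rewrite expr_div_n mulrA -E mulfK// expf_neq0.
have ds0 : d / s != 0 by rewrite mulf_neq0 ?invr_eq0.
(* The quotient by [xc f] above is now justified: if it vanished, Q f would be minus a square as
   well as al times a square, and -al would be a square. *)
have xf0 : xc f != 0.
  apply/eqP => xf0; apply: (nal (r := yc f / (d / s))).
  rewrite expr_div_n; have -> : yc f ^+ 2 = - (al * (d / s) ^+ 2).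
    by rewrite -QfE /Q xf0; ring.
  by rewrite mulNr mulfK// expf_neq0.
have Nf : N (xc f).
  apply/(norms_mul_sqr _ _ s'0); rewrite s'E.
  by have -> : xc f * (1 + t ^+ 2 * (xc h / xc f)) = xc (f + t ^+ 2 *: h)
    by rewrite !coordE; field.
have /MHV Hv : H f by apply/(H_char two0 al0 nal); split=> //; exists (d / s).
move: Hv => /(H_char two0 al0 nal)[_ [e e0]].
move/cone1P: cv => [p [q [_ ->]]]; rewrite /Q !coordE => /eqP.
have -> : p ^+ 2 * q ^+ 2 - (p * q) ^+ 2 = 0 by ring.
by rewrite eq_sym mulf_eq0 (negPf al0) sqrf_eq0 (negPf e0).
Qed.

(** On the cone, Q composed with M is a quartic in (s, t) that vanishes. The points (1, 0), (0, 1),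
    (1, 1), (1, -1) and a point (r, 1) with r (r^2 - 1) nonzero kill its five coefficients, and what
    remains is a multiple of Q. *)
Lemma isom_similitude : exists c, forall v, Q (M *m v) = c * Q v.
Proof.
pose e1 : V := mkv 1 0 0; pose e2 : V := mkv 0 1 0; pose e3 : V := mkv 0 0 1.
have dec v : M *m v = xc v *: (M *m e1) + yc v *: (M *m e2) + zc v *: (M *m e3).
  rewrite !scalemxAr -!mulmxDr; congr (_ *m _).
  by apply: coord_eq; rewrite !coordE; ring.
pose Q1 := Q (M *m e1); pose Q2 := Q (M *m e2); pose Q3 := Q (M *m e3).
pose B12 := B (M *m e1) (M *m e2); pose B13 := B (M *m e1) (M *m e3).
pose B23 := B (M *m e2) (M *m e3).
have QM v : Q (M *m v) = xc v ^+ 2 * Q1 + yc v ^+ 2 * Q2 + zc v ^+ 2 * Q3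
    + xc v * yc v * B12 + xc v * zc v * B13 + yc v * zc v * B23.
  by rewrite dec /Q1 /Q2 /Q3 /B12 /B13 /B23 !BE// /Q !coordE; ring.
have cone s t : s != 0 \/ t != 0 -> s ^+ 4 * Q1 + s ^+ 3 * t * B12
    + s ^+ 2 * t ^+ 2 * (Q2 + B13) + s * t ^+ 3 * B23 + t ^+ 4 * Q3 = 0.
  move=> st; rewrite -(isom_cone (v := mkv (s ^+ 2) (s * t) (t ^+ 2))).
    by rewrite QM !coordE; ring.
  by apply/cone1P; exists s, t.
have l0 := oner_neq0 k.
have q1 : Q1 = 0 by rewrite -[RHS](cone 1 0 (or_introl l0)); ring.
have q3 : Q3 = 0 by rewrite -[RHS](cone 0 1 (or_intror l0)); ring.
have := cone 1 1 (or_introl l0); have := cone 1 (-1) (or_introl l0).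
move=> cm cp.
have q2 : Q2 = - B13.
  apply/eqP; rewrite -addr_eq0; apply/eqP/(mulfI two0).
  rewrite mulr0 -[RHS]addr0 -[X in _ = X + _]cm -[X in _ = _ + X]cp.
  by rewrite q1 q3; ring.
have b23 : B23 = - B12.
  apply/eqP; rewrite -addr_eq0; apply/eqP; rewrite -[RHS]cp q1 q2 q3; ring.
have [r [r0 r1]] := exists_absv_lt1 k.
have b12 : B12 = 0.
  have /eqP : B12 * (r * (r ^+ 2 - 1)) = 0.
    by rewrite -[RHS](cone r 1 (or_introl r0)) q1 q2 q3 b23; ring.
  rewrite mulf_eq0 => /orP[/eqP//|].
  rewrite mulf_eq0 (negPf r0) /= subr_eq0 => /eqP rE.
  have := congr1 absv rE; rewrite absv1 absvX => /eqP.
  by rewrite sqrp_eq1 ?absv_ge0// lt_eqF.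
exists B13 => v; rewrite QM q1 q2 q3 b23 b12 /Q; ring.
Qed.

(** A similitude sends the isotropic vectors [e1] and [e3] to multiples of cone vectors, whose
    parameters are the columns of a matrix g. After division by [rho] g, both are eigenvectors, and
    the similitude relations make the map diagonal. *)
Lemma isom_rho : exists g c, [/\ g \in unitmx, N c & M = c *: rho g].
Proof.
have [c QM] := isom_similitude.
have BM v w : B (M *m v) (M *m w) = c * B v w.
  by rewrite /B -mulmxDr -mulmxBr !QM; ring.
have c0 : c != 0.
  have /MH/(H_char two0 al0 nal)[_ [d d0]] := H_vbase two0 al0 nal.
  rewrite QM => E; apply: contraNneq (d0) => c0; move/eqP: E.
  by rewrite c0 mul0r eq_sym mulf_eq0 (negPf al0) sqrf_eq0.
have Mneq0 v : v != 0 -> M *m v != 0.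
  by apply: contra => /eqP Mv; rewrite -[v]mul1mx -(mulVmx Mu) -mulmxA Mv mulmx0.
pose e1 : V := mkv 1 0 0; pose e2 : V := mkv 0 1 0; pose e3 : V := mkv 0 0 1.
have iso v : v != 0 -> Q v = 0 -> exists l s t,
    l != 0 /\ M *m v = l *: mkv (s ^+ 2) (s * t) (t ^+ 2).
  move=> v0 Qv; have [|l l0 [w /cone1P[s [t [_ ->]]] E]] :=
    isotropic_cone (Mneq0 _ v0); first by rewrite QM Qv mulr0.
  by exists l, s, t.
have e10 : e1 != 0 by rewrite coord_eq0 !coordE oner_eq0.
have e30 : e3 != 0 by rewrite coord_eq0 !coordE oner_eq0 !andbF.
have [l [s [t [l0 M1]]]] := iso e1 e10 ltac:(by rewrite /Q !coordE; ring).
have [m [s' [t' [m0 M3]]]] := iso e3 e30 ltac:(by rewrite /Q !coordE; ring).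
have cE : c = l * m * (s * t' - s' * t) ^+ 2.
  transitivity (B (M *m e1) (M *m e3)); first by rewrite BM BE// !coordE; ring.
  by rewrite M1 M3 BE// !coordE; ring.
pose g := mk2 s s' t t'.
have gu : g \in unitmx.
  rewrite unit2 !mk2E; apply: contraNneq c0 => d0.
  by rewrite cE d0 expr0n mulr0.
have gVu : invmx g \in unitmx by rewrite unitmx_inv.
have dg0 : \det (invmx g) != 0 by rewrite -unitfE -unitmxE.
pose M' := rho (invmx g) *m M.
have ME : M = rho g *m M' by rewrite mulmxA rhoK// mul1mx.
have M'1 : M' *m e1 = l *: e1.
  have -> : l *: e1 = rho (invmx g) *m (rho g *m (l *: e1)).
    by rewrite mulmxA rhoVK// mul1mx.
  rewrite -mulmxA M1; congr (_ *m _); rewrite rho_mul_vec//.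
  by apply: coord_eq; rewrite !coordE !mk2E; ring.
have M'3 : M' *m e3 = m *: e3.
  have -> : m *: e3 = rho (invmx g) *m (rho g *m (m *: e3)).
    by rewrite mulmxA rhoVK// mul1mx.
  rewrite -mulmxA M3; congr (_ *m _); rewrite rho_mul_vec//.
  by apply: coord_eq; rewrite !coordE !mk2E; ring.
pose c' := \det (invmx g) ^+ 2 * c.
have c'0 : c' != 0 by rewrite mulf_neq0 ?expf_neq0.
have BM' v w : B (M' *m v) (M' *m w) = c' * B v w.
  by rewrite -!mulmxA B_rho// BM mulrA.
have := BM' e1 e2; have := BM' e3 e2; have := BM' e2 e2; have := BM' e1 e3.
rewrite M'1 M'3 !BE// !coordE !(mul0r, mulr0, mul1r, mulr1, subr0, addr0, add0r, sub0r).
set x := xc (M' *m e2); set y := yc (M' *m e2); set z := zc (M' *m e2).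
move=> lm yy /eqP; rewrite mulf_eq0 (negPf m0) /= => /eqP x0.
move=> /eqP; rewrite mulf_eq0 (negPf l0) /= => /eqP z0.
have yl : y ^+ 2 = l * m.
  apply: (mulfI two0); apply: oppr_inj; rewrite lm.
  transitivity (x * z + z * x - 2%:R * y * y); first by rewrite x0 z0; ring.
  by rewrite yy; ring.
(* The map is diag(l, y, m) with y^2 = l m, that is l times the action of diag(1, y/l). *)
have hu : mk2 1 0 0 (y / l) \in unitmx.
  rewrite unit2 !mk2E mul1r mul0r subr0 mulf_neq0 ?invr_eq0//.
  by rewrite -sqrf_eq0 yl mulf_neq0.
have M'E : M' = l *: rho (mk2 1 0 0 (y / l)).
  apply: mx_eq_on_vec => v.
  have -> : M' *m v = xc v *: (M' *m e1) + yc v *: (M' *m e2) + zc v *: (M' *m e3).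
    rewrite !scalemxAr -!mulmxDr; congr (_ *m _).
    by apply: coord_eq; rewrite !coordE; ring.
  rewrite M'1 M'3 -scalemxAl rho_mul_vec//.
  apply: coord_eq; rewrite !coordE !mk2E -/x -/y -/z ?x0 ?z0; first by ring.
    by field.
  by rewrite expr_div_n yl; field.
have ghu : g *m mk2 1 0 0 (y / l) \in unitmx by rewrite unitmx_mul gu.
have MlE : M = l *: rho (g *m mk2 1 0 0 (y / l)).
  by rewrite ME M'E -scalemxAr rhoM.
exists (g *m mk2 1 0 0 (y / l)), l; split=> //.
(* To see that l is in K, M is applied to the preimage of [vbase] under the [rho] factor: the image
   l [vbase] is in H and has first coordinate l. *)
have ghVu : invmx (g *m mk2 1 0 0 (y / l)) \in unitmx by rewrite unitmx_inv.
have := H_rho two0 al0 nal ghVu (H_vbase two0 al0 nal).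
move=> /MH; rewrite MlE -scalemxAl mulmxA rhoK// mul1mx.
by move=> /(H_char two0 al0 nal)[]; rewrite !coordE mulr1.
Qed.

End Classification.
End Isometries.

(** * The projective action *)

Section Geometry.
Variables (R : realType) (k : nonArchLocalFieldType R).
Hypothesis two0 : (2%:R : k) != 0.
Variable al : k.
Hypotheses (al0 : al != 0) (nal : nonsquare (- al)).
Local Notation V := 'cV[k]_3.
Local Notation N := (norms (- al)).
Local Notation ba := (sqclass al).
Local Notation H := (H_ ba).
Local Notation K := (K_ ba).
Local Notation "[ v ]_K" := (orbit_of K v) (at level 0).
Implicit Types (u v w : V) (g h : 'M[k]_2) (M : 'M[k]_3) (c s t x y z : k).

Let KN : K = N. Proof. exact: K_norms. Qed.

Let K1 : K 1. Proof. by rewrite KN; exact: N1. Qed.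

Let KM c d : K c -> K d -> K (c * d).
Proof. by rewrite KN; exact: norms_mul. Qed.

Let KV c : K c -> K c^-1.
Proof. by rewrite KN; exact: norms_inv. Qed.

Let Kneq0 c : K c -> c != 0.
Proof. by case. Qed.

Let Ksqr c : c != 0 -> K (c ^+ 2).
Proof. by rewrite KN; exact: norms_sqr. Qed.

Section Orbits.
Variable W : lmodType k.
Implicit Types a b : W.

Lemma orbit_refl a : [a]_K a.
Proof. by exists 1; rewrite ?scale1r. Qed.

Lemma orbit_scale c a : K c -> [c *: a]_K = [a]_K.
Proof.
move=> Kc; apply/seteqP; split=> _ [d Kd <-].
  by exists (d * c); rewrite ?scalerA//; exact: KM.
by exists (d / c); [exact: KM (KV _) | rewrite scalerA divfK// Kneq0].
Qed.

Lemma orbit_eq a b : [a]_K = [b]_K -> exists2 c, K c & a = c *: b.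
Proof. by move=> ab; have := orbit_refl a; rewrite ab => -[c Kc <-]; exists c. Qed.

End Orbits.

Lemma proj_act_orbit M v : proj_act [M]_K [v]_K = [M *m v]_K.
Proof.
apply/seteqP; split=> [_ [_ [c Kc <-]] [_ [d Kd <-] <-]|_ [c Kc <-]].
  exists (c * d); first exact: KM.
  by rewrite -scalemxAl -scalemxAr scalerA.
exists M; first exact: orbit_refl.
by exists (c *: v); [exists c | rewrite scalemxAr].
Qed.

Lemma D_P p : D_ ba p <-> exists2 v, H v & p = [v]_K.
Proof.
split=> [[v [Hv _] <-]|[v Hv ->]]; first by exists v.
by exists v => //; split=> //; exact: (H_neq0 two0 al0 nal Hv).
Qed.

Lemma C_P p : C_ ba p <-> exists2 w, cone1 w & p = [w]_K.
Proof.
split=> [[w [cw _] <-]|[w cw ->]]; first by exists w.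
by exists w => //; split=> //; case: cw.
Qed.

Lemma D_orbit v : D_ ba [v]_K <-> H v.
Proof.
split=> [/D_P[w Hw /orbit_eq[c Kc ->]]|Hv]; last by apply/D_P; exists v.
by apply: (H_scale two0 al0 nal) Hw; rewrite -KN.
Qed.

Lemma H_rhoP g v : g \in unitmx -> H (rho g *m v) <-> H v.
Proof.
move=> gu; split=> [Hgv|]; last exact: (H_rho two0 al0 nal gu).
have gVu : invmx g \in unitmx by rewrite unitmx_inv.
have := H_rho two0 al0 nal gVu Hgv.
by rewrite mulmxA rhoVK// mul1mx.
Qed.

Lemma IsomDP f : IsomD ba f <-> exists2 g, g \in unitmx & f = [rho g]_K.
Proof.
split=> [[[M Mu <-] fD]|[g gu ->]].
  have [||g [c [gu Nc ->]]] := isom_rho two0 al0 nal Mu.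
  - move=> v /D_orbit Dv; apply/D_orbit; rewrite -proj_act_orbit -fD.
    by exists [v]_K.
  - move=> v /D_orbit; rewrite -fD => -[p /D_P[w Hw ->]].
    rewrite proj_act_orbit => /orbit_eq[c Kc MwE].
    have : v = c^-1 *: w.
      rewrite -[w]mul1mx -(mulVmx Mu) -mulmxA MwE -scalemxAr scalerA mulVf ?Kneq0//.
      by rewrite scale1r mulmxA mulVmx// mul1mx.
    by move=> ->; apply: (H_scale two0 al0 nal) Hw; rewrite -KN; exact: KV.
  by exists g => //; apply: orbit_scale; rewrite KN.
split; first by exists (rho g) => //; exact: rho_unit.
apply/seteqP; split=> [_ [p /D_P[v Hv ->] <-]|p /D_P[v Hv ->]].
  by rewrite proj_act_orbit; apply/D_orbit/H_rhoP.
exists [rho (invmx g) *m v]_K.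
  by apply/D_orbit/H_rhoP; rewrite ?unitmx_inv.
by rewrite proj_act_orbit mulmxA rhoK// mul1mx.
Qed.

Lemma proj_act_rhoK g p : g \in unitmx -> D_ ba p ->
  proj_act [rho (invmx g)]_K (proj_act [rho g]_K p) = p.
Proof.
by move=> gu /D_P[v _ ->]; rewrite !proj_act_orbit mulmxA rhoVK// mul1mx.
Qed.

(** Linear forms are carried along by composition with the inverse of [rho] g, which keeps their
    values; the same cross-ratios are thus realized at the image points. The other inclusion comes
    from the inverse of g. *)
Lemma cross_ratios_rho g p q : g \in unitmx -> D_ ba p -> D_ ba q ->
  cross_ratios ba p q `<=`
  cross_ratios ba (proj_act [rho g]_K p) (proj_act [rho g]_K q).
Proof.
move=> gu Dp Dq t [phi [phi' [f [f' [u [v [[Dphi Dphi' phif phif'] [pu qv ->]]]]]]]].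
have gVu : invmx g \in unitmx by rewrite unitmx_inv.
have dual psi f0 : Ddual ba psi -> psi f0 -> Ddual ba [f0 *m rho (invmx g)]_K.
  move=> [[e e0 psiE] psiP] psif0; split.
    exists (f0 *m rho (invmx g)) => //.
    move: psif0; rewrite psiE => -[c Kc f0E].
    have : f0 != 0 by rewrite -f0E scaler_eq0 negb_or Kneq0.
    apply: contra => /eqP E.
    by rewrite -[f0]mulmx1 -(rhoVK gu) mulmxA E mul0mx.
  move=> _ _ w [c Kc <-] /D_P[w0 Hw0 ->] [d Kd <-].
  have := psiP f0 [rho (invmx g) *m w0]_K (rho (invmx g) *m w0) psif0.
  move=> /(_ ((D_orbit _).2 ((H_rhoP w0 gVu).2 Hw0)) (orbit_refl _)).
  have -> : ev (c *: (f0 *m rho (invmx g))) (d *: w0) =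
      c * d * ev f0 (rho (invmx g) *m w0).
    by rewrite /ev -scalemxAr -[(c *: _) *m _]scalemxAl scalerA mxE [d * c]mulrC mulmxA.
  exact: KM (KM _ _).
have evg f0 w : ev (f0 *m rho (invmx g)) (rho g *m w) = ev f0 w.
  by rewrite /ev mulmxA -[f0 *m _ *m _]mulmxA rhoVK// mulmx1.
exists [f *m rho (invmx g)]_K, [f' *m rho (invmx g)]_K,
  (f *m rho (invmx g)), (f' *m rho (invmx g)), (rho g *m u), (rho g *m v).
split; split; rewrite ?evg//; try exact: orbit_refl.
- exact: dual Dphi phif.
- exact: dual Dphi' phif'.
- by exists (rho g); [exact: orbit_refl | exists u].
- by exists (rho g); [exact: orbit_refl | exists v].
Qed.

Lemma hilbert_dist_isom (mu : {measure set (borel_type k) -> \bar R}) f p q :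
  IsomD ba f -> D_ ba p -> D_ ba q ->
  hilbert_dist ba mu (proj_act f p) (proj_act f q) = hilbert_dist ba mu p q.
Proof.
move=> If Dp Dq; have /IsomDP[g gu fE] := If; rewrite /hilbert_dist.
congr (mu (smallest_symball _ _)); apply/seteqP; split; rewrite fE; last first.
  exact: cross_ratios_rho.
have gVu : invmx g \in unitmx by rewrite unitmx_inv.
have Dg r : D_ ba r -> D_ ba (proj_act [rho g]_K r).
  by move=> /D_P[v Hv ->]; rewrite proj_act_orbit; apply/D_orbit/H_rhoP.
rewrite -{2}(proj_act_rhoK gu Dp) -{2}(proj_act_rhoK gu Dq).
exact: cross_ratios_rho gVu (Dg _ Dp) (Dg _ Dq).
Qed.

(** * The isomorphism with PGL(2) *)

Definition PGL_to_Isom (G : set 'M[k]_2) : set 'M[k]_3 :=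
  [set c *: rho g | c in K & g in G].

(** Scalars act by squares, which are in K, so the union over all representatives is a single
    K-orbit. *)
Lemma PGL_to_Isom_orbit g : g \in unitmx ->
  PGL_to_Isom (orbit_of (kstar k) g) = [rho g]_K.
Proof.
move=> gu; apply/seteqP; split=> [_ [c Kc [_ [s s0 <-] <-]]|_ [c Kc <-]].
  exists (c * s ^+ 2); first exact: KM (Ksqr _).
  by rewrite rhoZ// scalerA.
exists c => //; exists g => //; exists 1; rewrite ?scale1r//.
by rewrite /kstar /= oner_neq0.
Qed.

(** This is the kernel of the action: the images of the basis vectors show that the off-diagonal
    entries have square 0, and that the square of the first diagonal entry and the product of both
    are c. *)
Lemma rho_scalar_eq c g : g \in unitmx -> rho g = c *: 1%:M ->
  exists2 s, s != 0 & g = s *: 1%:M.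
Proof.
move=> gu gE; have rhoE v : rho g *m v = c *: v by rewrite gE -scalemxAl mul1mx.
have := rhoE (mkv 0 0 1); have := rhoE (mkv 1 0 0).
rewrite !rho_mul_vec// => /[dup] /(congr1 (@xc k)) + /(congr1 (@zc k)).
rewrite !coordE => e1 e2 /[dup] /(congr1 (@xc k)) + /(congr1 (@yc k)).
rewrite !coordE => e3 e4.
have := rhoE (mkv 0 1 0); rewrite rho_mul_vec// => /(congr1 (@yc k)).
rewrite !coordE => e5.
have g10 : g 1 0 = 0.
  by apply/eqP; rewrite -sqrf_eq0; apply/eqP; rewrite -[RHS](mulr0 c) -e2; ring.
have g01 : g 0 1 = 0.
  by apply/eqP; rewrite -sqrf_eq0; apply/eqP; rewrite -[RHS](mulr0 c) -e3; ring.
move: (gu); rewrite unit2 g10 g01 mul0r subr0 mulf_eq0 negb_or => /andP[g00 g11].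
have gd : g 0 0 = g 1 1.
  apply: (mulfI g00); transitivity c.
    by rewrite -[RHS]mulr1 -e1; ring.
  by rewrite -[LHS]mulr1 -e5 g10; ring.
exists (g 0 0) => //; apply/matrixP => i j; rewrite !mxE.
case: i => [[|[|//]]] p; case: j => [[|[|//]]] q /=.
- by rewrite mulr1; congr (g _ _); exact/val_inj.
- by rewrite mulr0 -[RHS]g01; congr (g _ _); exact/val_inj.
- by rewrite mulr0 -[RHS]g10; congr (g _ _); exact/val_inj.
- by rewrite mulr1 gd; congr (g _ _); exact/val_inj.
Qed.

Lemma PGL_to_Isom_bij : set_bij (PGL2 k) (IsomD ba) PGL_to_Isom.
Proof.
split.
- move=> _ [g gu <-]; rewrite PGL_to_Isom_orbit//.
  by apply/IsomDP; exists g.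
- move=> G G'; rewrite !inE => -[g gu <-] [h hu <-].
  rewrite !PGL_to_Isom_orbit// => /orbit_eq[c Kc gh].
  have hVu : invmx h \in unitmx by rewrite unitmx_inv.
  have hgu : invmx h *m g \in unitmx by rewrite unitmx_mul hVu.
  have [|s s0 hgE] := @rho_scalar_eq c _ hgu.
    by rewrite rhoM// gh -scalemxAr rhoVK.
  have gE : g = s *: h.
    by rewrite -[g]mul1mx -(mulmxV hu) -mulmxA hgE -scalemxAr mulmx1.
  rewrite gE; apply/seteqP; split=> _ [d d0 <-].
    by exists (d * s); rewrite ?scalerA// /kstar /= mulf_neq0.
  exists (d / s); first by rewrite /kstar /= mulf_neq0 ?invr_eq0.
  by rewrite scalerA divfK.
- move=> f /IsomDP[g gu ->]; exists (orbit_of (kstar k) g); first by exists g.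
  exact: PGL_to_Isom_orbit.
Qed.

Lemma PGL_to_Isom_mul G G' : PGL2 k G -> PGL2 k G' ->
  PGL_to_Isom (coset_mul G G') = coset_mul (PGL_to_Isom G) (PGL_to_Isom G').
Proof.
have sub g a : g \in unitmx -> orbit_of (kstar k) g a -> a \in unitmx.
  by move=> gu [s s0 <-]; rewrite unitmxZ ?unitfE.
move=> [g gu <-] [h hu <-]; apply/seteqP; split.
  move=> _ [c Kc [_ [a ga [b hb <-]] <-]].
  exists (c *: rho a); first by exists c => //; exists a.
  exists (1 *: rho b); first by exists 1 => //; exists b.
  by rewrite scale1r rhoM ?scalemxAl//; [exact: sub ga | exact: sub hb].
move=> _ [_ [c Kc [a ga <-]] [_ [d Kd [b hb <-]] <-]].
exists (c * d); first exact: KM.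
exists (a *m b); first by exists a => //; exists b.
rewrite rhoM; [|exact: sub ga|exact: sub hb].
by rewrite -[RHS]scalemxAl -[X in _ = _ *: X]scalemxAr scalerA.
Qed.

Lemma disc_cone_transitive :
  acts_transitively (fun f (xc : set 'cV[k]_3 * set 'cV[k]_3) =>
      (proj_act f xc.1, proj_act f xc.2))
    (IsomD ba) (D_ ba `*` C_ ba).
Proof.
split=> [f [p q] /IsomDP[g gu ->] [/D_P[v Hv ->] /C_P[w cw ->]]|].
  rewrite !proj_act_orbit; split; first by apply/D_orbit/H_rhoP.
  by apply/C_P; exists (rho g *m w) => //; exact: cone1_rho.
move=> [p q] [p' q'] [/D_P[v Hv /= ->] /C_P[w cw /= ->]].
move=> [/D_P[v' Hv' /= ->] /C_P[w' cw' /= ->]].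
have [g [c [gu Nc vE wE]]] := disc_cone_orbit two0 al0 nal Hv cw.
have [h [d [hu Nd vE' wE']]] := disc_cone_orbit two0 al0 nal Hv' cw'.
have gVu : invmx g \in unitmx by rewrite unitmx_inv.
exists [rho (h *m invmx g)]_K.
  by apply/IsomDP; exists (h *m invmx g); rewrite // unitmx_mul hu.
have E u : rho (h *m invmx g) *m (rho g *m u) = rho h *m u.
  by rewrite rhoM// -mulmxA [_ *m (rho g *m u)]mulmxA rhoVK// mul1mx.
rewrite !proj_act_orbit -wE E wE'; congr pair.
have [Kc Kd] : K c /\ K d by rewrite KN.
by rewrite -(orbit_scale v' Kd) -vE' -E vE -scalemxAr orbit_scale.
Qed.

(** * Lines, planes and flags *)

Definition line_of (P : {vspace V}) := D_ ba `&` imageS ba [set` P].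

Lemma line_ofP P p : line_of P p <-> exists v, [/\ H v, v \in P & p = [v]_K].
Proof.
split=> [[/D_P[v Hv pE] [w [wP w0] wE]]|[v [Hv vP ->]]].
  exists v; split=> //; have [c Kc ->] := orbit_eq (etrans (esym pE) (esym wE)).
  exact: rpredZ.
split; first exact/D_orbit.
by exists v => //; split=> //; exact: (H_neq0 two0 al0 nal Hv).
Qed.

Lemma line_of_orbit P v : line_of P [v]_K <-> H v /\ v \in P.
Proof.
split=> [/line_ofP[w [Hw wP vw]]|[Hv vP]]; last by apply/line_ofP; exists v.
have [c Kc ->] := orbit_eq vw; split; last exact: rpredZ.
by apply: (H_scale two0 al0 nal) Hw; rewrite -KN.
Qed.

Definition plane_image g (P : {vspace V}) : {vspace V} :=
  (linfun (mulmx (rho g)) @: P)%VS.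

Lemma mem_plane_image g P v : g \in unitmx ->
  (rho g *m v \in plane_image g P) = (v \in P).
Proof.
move=> gu; have -> : rho g *m v = linfun (mulmx (rho g)) v by rewrite lfunE.
apply/idP/idP => [/memv_imgP[u uP]|vP]; last exact: memv_img.
rewrite !lfunE /= => /(congr1 (mulmx (rho (invmx g)))).
by rewrite !mulmxA rhoVK// !mul1mx => ->.
Qed.

Lemma plane_imageP g P v : g \in unitmx -> v \in plane_image g P ->
  exists2 u, u \in P & v = rho g *m u.
Proof. by move=> gu /memv_imgP[u uP ->]; exists u; rewrite // lfunE. Qed.

Lemma dim_plane_image g P : g \in unitmx -> \dim (plane_image g P) = \dim P.
Proof.
move=> gu; apply: limg_dim_eq; apply/eqP; rewrite -subv0; apply/subvP => v.
rewrite memv_cap => /andP[_]; rewrite memv_ker lfunE /= memv0 => /eqP gv.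
by rewrite -[v]mul1mx -(rhoVK gu) -mulmxA gv mulmx0.
Qed.

Lemma set_act_line g P : g \in unitmx ->
  set_act [rho g]_K (line_of P) = line_of (plane_image g P).
Proof.
move=> gu; apply/seteqP; split=> [_ [_ /line_ofP[v [Hv vP ->]] <-]|p].
  by rewrite proj_act_orbit; apply/line_of_orbit; rewrite H_rhoP// mem_plane_image.
move=> /line_ofP[v [Hv /(plane_imageP gu)[u uP vE] ->]].
exists [u]_K; last by rewrite proj_act_orbit vE.
by apply/line_of_orbit; split=> //; apply/(H_rhoP u gu); rewrite -vE.
Qed.

Lemma line_plane_rho g l P : g \in unitmx -> line_plane ba l P ->
  line_plane ba (set_act [rho g]_K l) (plane_image g P).
Proof.
move=> gu [dP lE [p lp]]; split; first by rewrite dim_plane_image.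
  by rewrite lE; exact: set_act_line.
by exists (proj_act [rho g]_K p); exists p.
Qed.

Lemma spans_orthP P v w : spans_orth P v w <->
  [/\ w \in P, B v w = 0 &
      forall u, u \in P -> B v u = 0 -> exists a, u = a *: w].
Proof.
split=> [E|[wP vw Pw]].
  have /= [] : ([set` P] `&` [set u | B v u = 0]) w by rewrite -E /=; exact: memv_line.
  move=> wP vw; split=> // u uP vu.
  have /= : [set` <[w]>%VS] u by rewrite E.
  by move=> /vlineP.
apply/seteqP; split=> [u /= /vlineP[a ->]|u [/= uP vu]].
  by split=> /=; [exact: rpredZ | rewrite BZr// vw mulr0].
by apply/vlineP; exact: Pw.
Qed.

Let Q_neq0 v : H v -> Q v != 0.
Proof.
by move=> /(H_char two0 al0 nal)[_ [d d0 ->]]; rewrite mulf_neq0// expf_neq0.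
Qed.

Let Bvv_neq0 v : H v -> B v v != 0.
Proof. by move=> Hv; rewrite Bvv// mulf_neq0// Q_neq0. Qed.

(** Since Q is nonzero on H, a point v of H is not orthogonal to itself, and P splits as k v plus
    its part orthogonal to v. *)
Lemma plane_decomp P v w : \dim P = 2%N -> H v -> v \in P -> spans_orth P v w ->
  w != 0 /\ forall u, u \in P <-> exists a b, u = a *: v + b *: w.
Proof.
move=> dP Hv vP /spans_orthP[wP vw Pw]; have vv := Bvv_neq0 Hv.
have dec u : u \in P <-> exists a b, u = a *: v + b *: w.
  split=> [uP|[a [b ->]]]; last by apply: rpredD; exact: rpredZ.
  pose a := B v u / B v v.
  have [|b bE] := Pw (u - a *: v) (rpredB uP (rpredZ _ vP)).
    by rewrite BDr// -scaleNr BZr// mulNr divfK// subrr.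
  by exists a, b; rewrite -bE addrC subrK.
split=> //; apply/eqP => w0.
have : (P <= <[v]>)%VS.
  apply/subvP => u /dec[a [b ->]]; rewrite w0 scaler0 addr0.
  exact/rpredZ/memv_line.
by move=> /dimvS; rewrite dP dim_vline; case: (v != 0).
Qed.

Lemma spans_orth_exists P v : \dim P = 2%N -> H v -> v \in P ->
  exists w, spans_orth P v w.
Proof.
move=> dP Hv vP; have vv := Bvv_neq0 Hv.
have v0 := H_neq0 two0 al0 nal Hv.
have [u uP uv] : exists2 u, u \in P & u \notin <[v]>%VS.
  apply: contrapT => no; have : (P <= <[v]>)%VS.
    apply/subvP => u uP; apply: contrapT => /negP uv.
    by apply: no; exists u.
  by move=> /dimvS; rewrite dP dim_vline; case: (v != 0).
pose w := u - (B v u / B v v) *: v.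
have wP : w \in P by apply: rpredB => //; exact: rpredZ.
have vw : B v w = 0 by rewrite /w BDr// -scaleNr BZr// mulNr divfK// subrr.
have wv : w \notin <[v]>%VS.
  apply: contra uv => wv; rewrite -[u](subrK ((B v u / B v v) *: v)).
  by apply: rpredD => //; exact/rpredZ/memv_line.
have PE : (<[v]> + <[w]>)%VS = P.
  apply/eqP; rewrite eqEdim subv_add -!memvE vP wP /= dP.
  rewrite dimv_disjoint_sum.
    by rewrite !dim_vline v0; case: eqP wv => // ->; rewrite mem0v.
  apply/eqP; rewrite -subv0; apply/subvP => x; rewrite memv_cap memv0.
  move=> /andP[xv /vlineP[a xE]]; move: xv; rewrite xE.
  have [->|a0] := eqVneq a 0; first by rewrite scale0r.
  by move=> xv; case/negP: wv; rewrite -[w](scalerK a0); exact: rpredZ.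
exists w; apply/spans_orthP; split=> // x.
rewrite -PE => /memv_addP[_ /vlineP[a ->] [_ /vlineP[b ->] ->]].
rewrite BDr// !BZr// vw mulr0 addr0 => /eqP; rewrite mulf_eq0 (negPf vv) orbF.
by move=> /eqP ->; exists b; rewrite scale0r add0r.
Qed.

Lemma spans_orth_rho g P v w : g \in unitmx -> spans_orth P v w ->
  spans_orth (plane_image g P) (rho g *m v) (rho g *m w).
Proof.
move=> gu /spans_orthP[wP vw Pw]; apply/spans_orthP.
have dg : \det g ^+ 2 != 0 by rewrite expf_neq0// -unitfE -unitmxE.
split; first by rewrite mem_plane_image.
  by rewrite B_rho// vw mulr0.
move=> _ /(plane_imageP gu)[u uP ->]; rewrite B_rho// => /eqP.
rewrite mulf_eq0 (negPf dg) /= => /eqP vu.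
by have [a ->] := Pw u uP vu; exists a; rewrite scalemxAr.
Qed.

(** On the orthogonal of [vbase], -Q is the norm form y^2 + al x^2; the action, transitive up to K,
    changes Q only by squares. *)
Lemma spans_orth_norm P v w : \dim P = 2%N -> H v -> v \in P ->
  spans_orth P v w -> N (- Q w).
Proof.
move=> dP Hv vP vw; have [w0 _] := plane_decomp dP Hv vP vw.
have /spans_orthP[_ {}vw _] := vw.
have [g [c [gu Nc vE]]] := H_orbit two0 al0 nal Hv.
have gVu : invmx g \in unitmx by rewrite unitmx_inv.
have dg : \det g != 0 by rewrite -unitfE -unitmxE.
pose u := rho (invmx g) *m w.
have wE : w = rho g *m u by rewrite /u mulmxA rhoK// mul1mx.
have u0 : u != 0 by apply: contra w0 => /eqP u0; rewrite wE u0 mulmx0.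
move: vw => /eqP; rewrite vE BZl// wE B_rho// mulf_eq0 (negPf (norms_neq0 Nc)) /=.
rewrite mulf_eq0 sqrf_eq0 (negPf dg) /= BE// !coordE => /eqP bu.
have zE : zc u = - (al * xc u).
  apply/eqP; rewrite -addr_eq0 -bu; apply/eqP; ring.
rewrite Q_rho// -mulrN mulrC; apply/norms_mul_sqr => //.
have -> : - Q u = yc u ^+ 2 + al * xc u ^+ 2 by rewrite /Q zE; ring.
apply: norms_form => //; apply/orP; rewrite -negb_and.
apply: contra u0 => /andP[/eqP y0 /eqP x0].
by rewrite coord_eq0 zE x0 y0 mulr0 oppr0 eqxx.
Qed.

(* Up to squares, Q(v) Q(w) is the discriminant of Q on the plane P. *)
Lemma spans_orth_class P v w v' w' : \dim P = 2%N -> H v -> v \in P ->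
  H v' -> v' \in P -> spans_orth P v w -> spans_orth P v' w' ->
  exists2 r, r != 0 & Q w' = Q w * r ^+ 2.
Proof.
move=> dP Hv vP Hv' vP' vw vw'.
have [_ dec] := plane_decomp dP Hv vP vw.
have Nw' := spans_orth_norm dP Hv' vP' vw'.
have /spans_orthP[_ vw0 _] := vw; have /spans_orthP[wP' vw0' _] := vw'.
have [a [b v'E]] := (dec v').1 vP'; have [c [d w'E]] := (dec w').1 wP'.
move: (Hv) (Hv') => /(H_char two0 al0 nal)[_ [m m0 mE]].
move=> /(H_char two0 al0 nal)[_ [n n0 nE]].
(* Gram determinants in P differ by the square of the determinant of the change of basis. As Q v and
   Q v' are both al times a square, they cancel modulo squares. *)
have gram : Q v' * Q w' = Q v * Q w * (a * d - b * c) ^+ 2.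
  have : 4%:R * (Q v' * Q w') = B v' v' * B w' w' - B v' w' ^+ 2.
    by rewrite vw0' !Bvv//; ring.
  have gr : B v' v' * B w' w' - B v' w' ^+ 2 =
      (B v v * B w w - B v w ^+ 2) * (a * d - b * c) ^+ 2.
    by rewrite v'E w'E !BE// !coordE; ring.
  rewrite gr vw0 !Bvv// => E.
  have four0 : 4%:R != 0 :> k.
    by rewrite (_ : 4%:R = 2%:R * 2%:R :> k) ?mulf_neq0//; ring.
  by apply: (mulfI four0); rewrite E; ring.
have QE : Q w' = Q w * ((a * d - b * c) * m / n) ^+ 2.
  apply: (mulfI (Q_neq0 Hv')); rewrite gram mE nE.
  by field.
exists ((a * d - b * c) * m / n) => //.
apply: contraNneq (norms_neq0 Nw') => r0.
by rewrite QE r0 expr0n mulr0 oppr0.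
Qed.

Lemma flag_line_orbit P P' v v' w w' r : \dim P = 2%N -> \dim P' = 2%N ->
  H v -> v \in P -> H v' -> v' \in P' -> spans_orth P v w ->
  spans_orth P' v' w' -> Q w = Q w' * r ^+ 2 ->
  exists2 f, IsomD ba f &
    proj_act f [v]_K = [v']_K /\ set_act f (line_of P) = line_of P'.
Proof.
move=> dP dP' Hv vP Hv' vP' vw vw' QE.
have [w0 dec] := plane_decomp dP Hv vP vw.
have [w0' dec'] := plane_decomp dP' Hv' vP' vw'.
have /spans_orthP[_ vw0 _] := vw; have /spans_orthP[_ vw0' _] := vw'.
have [g [c [l [gu Nc gv l0 gw]]]] :=
  flag_orbit two0 al0 nal Hv Hv' vw0 vw0' w0 w0' QE.
have c0 := norms_neq0 Nc.
exists [rho g]_K; first by apply/IsomDP; exists g.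
split; first by rewrite proj_act_orbit gv; apply: orbit_scale; rewrite KN.
rewrite set_act_line//; congr line_of; apply/vspaceP => u.
apply/idP/idP => [/(plane_imageP gu)[x /dec[a [b ->]] ->]|/dec'[a [b ->]]].
  apply/dec'; exists (a * c), (b * l).
  by rewrite mulmxDr -!scalemxAr gv gw !scalerA.
have -> : a *: v' + b *: w' = rho g *m ((a / c) *: v + (b / l) *: w).
  by rewrite mulmxDr -!scalemxAr gv gw !scalerA !divfK.
by rewrite mem_plane_image//; apply/dec; exists (a / c), (b / l).
Qed.

Let baP t : t != 0 -> ba t <-> exists r, t = al * r ^+ 2.
Proof.
move=> t0; split=> [[r _ <-]|[r tE]]; first by exists r.
exists r => //; rewrite /kstar /=; apply: contraNneq t0 => r0.
by rewrite tE r0 expr0n mulr0.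
Qed.

Let ba_sqr s t : t != 0 -> ba (s * t ^+ 2) <-> ba s.
Proof.
move=> t0; split=> -[r r0 rE]; last first.
  by exists (r * t); [rewrite /kstar /= mulf_neq0 | rewrite -rE; ring].
exists (r / t); first by rewrite /kstar /= mulf_neq0 ?invr_eq0.
by rewrite expr_div_n mulrA rE mulfK// expf_neq0.
Qed.

Lemma long_line_rho g l : g \in unitmx -> long_line ba l ->
  long_line ba (set_act [rho g]_K l).
Proof.
move=> gu [P [v [w [lP Hv lv vw Qw]]]].
exists (plane_image g P), (rho g *m v), (rho g *m w); split.
- exact: line_plane_rho.
- exact/H_rhoP.
- by exists [v]_K => //; exact: proj_act_orbit.
- exact: spans_orth_rho.
- by rewrite Q_rho// -mulrN mulrC; apply/ba_sqr; rewrite // -unitfE -unitmxE.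
Qed.

Lemma short_line_rho g l : g \in unitmx -> short_line ba l ->
  short_line ba (set_act [rho g]_K l).
Proof.
move=> gu [P [v [w [lP Hv lv vw Qw]]]].
exists (plane_image g P), (rho g *m v), (rho g *m w); split.
- exact: line_plane_rho.
- exact/H_rhoP.
- by exists [v]_K => //; exact: proj_act_orbit.
- exact: spans_orth_rho.
- by rewrite Q_rho// -mulrN mulrC => /ba_sqr; rewrite -unitfE -unitmxE => /(_ gu).
Qed.

(** A long line comes with one particular point; by [spans_orth_class] the point p of the flag can
    replace it. *)
Lemma long_flagP p l : long_flag ba (p, l) -> exists P v w,
  [/\ \dim P = 2%N, l = line_of P & p = [v]_K] /\
  [/\ H v, v \in P, spans_orth P v w & ba (- Q w)].
Proof.
move=> [/= [P [v [w [[dP lE _] Hv lv vw Qw]]]] lp].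
have vP : v \in P by move: lv; rewrite lE => /line_of_orbit[].
move: lp; rewrite lE => /line_ofP[v' [Hv' vP' ->]].
have [w' vw'] := spans_orth_exists dP Hv' vP'.
exists P, v', w'; split=> //; split=> //.
have [r r0 ->] := spans_orth_class dP Hv vP Hv' vP' vw vw'.
by rewrite -mulNr; exact/ba_sqr.
Qed.

Lemma long_flag_transitive :
  acts_transitively (fun f (vL : set 'cV[k]_3 * set (set 'cV[k]_3)) =>
      (proj_act f vL.1, set_act f vL.2))
    (IsomD ba) (long_flag ba).
Proof.
split=> [f [p l] /IsomDP[g gu ->] [/= ll lp]|[p l] [p' l']].
  by split=> /=; [exact: long_line_rho | exists p].
move=> /long_flagP[P [v [w [[dP -> ->] [Hv vP vw Qw]]]]].
move=> /long_flagP[P' [v' [w' [[dP' -> ->] [Hv' vP' vw' Qw']]]]].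
have [r r0 rE] := Qw; have [s s0 sE] := Qw'.
have [|f If [fv fP]] := @flag_line_orbit P P' v v' w w' (r / s) dP dP' Hv vP Hv' vP' vw vw'.
  rewrite -[Q w]opprK -rE -[Q w']opprK -sE expr_div_n.
  by field; rewrite [_ != 0]s0.
by exists f => //=; rewrite fv fP.
Qed.

Lemma long_line_transitive :
  acts_transitively (@set_act k) (IsomD ba) (long_line ba).
Proof.
split=> [f l /IsomDP[g gu ->]|l l' ll ll']; first exact: long_line_rho.
have point l0 : long_line ba l0 -> exists p, long_flag ba (p, l0).
  by move=> ll0; have [P [v [w [_ _ lv _ _]]]] := ll0; exists [v]_K.
have [p lp] := point _ ll; have [p' lp'] := point _ ll'.
by have [f If [_ fl]] := long_flag_transitive.2 _ _ lp lp'; exists f.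
Qed.

(** For a short line -Q w is a norm outside the class of al, and al is itself a norm. In odd residue
    characteristic only one class is left, and two lines with marked points are then exchanged as
    flags. *)
Lemma short_line_transitive : odd_residue_char k ->
  acts_transitively (@set_act k) (IsomD ba) (short_line ba).
Proof.
move=> k2; split=> [f l /IsomDP[g gu ->]|l l']; first exact: short_line_rho.
move=> [P [v [w [[dP lE _] Hv lv vw Qw]]]].
move=> [P' [v' [w' [[dP' lE' _] Hv' lv' vw' Qw']]]].
have vP : v \in P by move: lv; rewrite lE => /line_of_orbit[].
have vP' : v' \in P' by move: lv'; rewrite lE' => /line_of_orbit[].
have Nw := spans_orth_norm dP Hv vP vw.
have Nw' := spans_orth_norm dP' Hv' vP' vw'.
have Nal : N al by split=> //; exists 0, 1; ring.
have nal0 : - al != 0 by rewrite oppr_eq0.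
have [||r rE] := norms_odd_residue two0 nal0 nal k2 Nw Nw' Nal.
- by move=> /baP; rewrite (norms_neq0 Nw) => /(_ isT).
- by move=> /baP; rewrite (norms_neq0 Nw') => /(_ isT).
have [|f If [_ fP]] := @flag_line_orbit P P' v v' w w' r dP dP' Hv vP Hv' vP' vw vw'.
  by apply: oppr_inj; rewrite rE mulNr.
by exists f => //; rewrite lE lE'.
Qed.

Lemma orthogonal_at_isom f p l1 l2 : IsomD ba f -> orthogonal_at ba p l1 l2 ->
  orthogonal_at ba (proj_act f p) (set_act f l1) (set_act f l2).
Proof.
move=> /IsomDP[g gu ->] [P1 [P2 [v [[lP1 lP2 Hv ->] [l1v l2v orth]]]]].
have dg : \det g ^+ 2 != 0 by rewrite expf_neq0// -unitfE -unitmxE.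
exists (plane_image g P1), (plane_image g P2), (rho g *m v); split; split.
- exact: line_plane_rho.
- exact: line_plane_rho.
- exact/H_rhoP.
- exact: proj_act_orbit.
- by exists [v]_K.
- by exists [v]_K.
move=> _ _ /(plane_imageP gu)[w1 w1P ->] + /(plane_imageP gu)[w2 w2P ->].
rewrite !B_rho// => /eqP; rewrite mulf_eq0 (negPf dg) /= => /eqP v1 /eqP.
rewrite mulf_eq0 (negPf dg) /= => /eqP v2.
by rewrite orth// mulr0.
Qed.

End Geometry.

Theorem proposition4p2 (R : realType) (k : nonArchLocalFieldType R)
    (mu : {measure set (borel_type k) -> \bar R}) (ba : set k)
    (char_k : 2%N \notin [pchar k])
    (haar_mu : is_haar mu)
    (ba_class : sqclasses k ba)
    (ba_m1 : ~ ba (-1)) :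
  (forall f x y, IsomD ba f -> D_ ba x -> D_ ba y ->
     hilbert_dist ba mu (proj_act f x) (proj_act f y) = hilbert_dist ba mu x y)
  /\
  (exists Phi : set 'M[k]_2 -> set 'M[k]_3,
     [/\ set_bij (PGL2 k) (IsomD ba) Phi,
         (forall g h, PGL2 k g -> PGL2 k h ->
            Phi (coset_mul g h) = coset_mul (Phi g) (Phi h))
       & (forall g : 'M[k]_2, g \in unitmx ->
            Phi (orbit_of (kstar k) g) =
            orbit_of (K_ ba) (\det g *: Ad_mx g))])
  /\
  acts_transitively (fun f (xc : set 'cV[k]_3 * set 'cV[k]_3) =>
      (proj_act f xc.1, proj_act f xc.2))
    (IsomD ba) (D_ ba `*` C_ ba)
  /\
  acts_transitively (@set_act k) (IsomD ba) (long_line ba)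
  /\
  (odd_residue_char k ->
   acts_transitively (@set_act k) (IsomD ba) (short_line ba))
  /\
  acts_transitively (fun f (vL : set 'cV[k]_3 * set (set 'cV[k]_3)) =>
      (proj_act f vL.1, set_act f vL.2))
    (IsomD ba) (long_flag ba)
  /\
  (forall f v l1 l2, IsomD ba f -> orthogonal_at ba v l1 l2 ->
     orthogonal_at ba (proj_act f v) (set_act f l1) (set_act f l2)).
Proof.
have two0 : (2%:R : k) != 0 by move: char_k; rewrite inE.
case: ba_class ba_m1 => al al0 <- am1.
have nal : nonsquare (- al).
  move=> r rE; apply: am1; exists r^-1.
    rewrite /kstar /= invr_eq0; apply: contraNneq al0 => r0.
    by rewrite -oppr_eq0 rE r0 expr0n.
  by rewrite exprVn -rE invrN mulrN divff.
split; first by move=> f x y; exact: hilbert_dist_isom.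
split.
  exists (PGL_to_Isom al); split.
  - exact: PGL_to_Isom_bij.
  - by move=> g h; exact: PGL_to_Isom_mul.
  - by move=> g; exact: PGL_to_Isom_orbit.
split; first exact: disc_cone_transitive.
split; first exact: long_line_transitive.
split; first exact: short_line_transitive.
split; first exact: long_flag_transitive.
exact: orthogonal_at_isom.
Qed.
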